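(* Let $X$ be a compact Hausdorff space with Borel $\sigma$-algebra $\mathcal{O}(X)$, let $\mathcal{A}$ be a unital $C^*$-algebra and $\mathcal{H}$ a Hilbert space. Then there is a one-to-one correspondence between regular CP instruments $\mathcal{I}:\mathcal{O}(X)\to CP(\mathcal{A},\mathcal{B}(\mathcal{H}))$ on $(X,\mathcal{O}(X))$ and completely positive maps from $C(X,\mathcal{A})$ to $\mathcal{B}(\mathcal{H})$, where $C(X,\mathcal{A})$ denotes the $C^*$-algebra of $\mathcal{A}$-valued continuous functions on $X$.
   Context: Hilbert spaces are complex, with inner products anti-linear in the first variable. $\mathcal{B}(\mathcal{H})$ is the $C^*$-algebra of all bounded linear operators on $\mathcal{H}$, and $CP(\mathcal{A},\mathcal{B}(\mathcal{H}))$ is the set of completely positive linear maps $\mathcal{A}\to\mathcal{B}(\mathcal{H})$. A CP instrument on $(X,\mathcal{O}(X))$ with values in $CP(\mathcal{A},\mathcal{B}(\mathcal{H}))$ is a map $\mathcal{I}:\mathcal{O}(X)\to CP(\mathcal{A},\mathcal{B}(\mathcal{H}))$ such that for all $h,k\in\mathcal{H}$ and $a\in\mathcal{A}$ the set function $A\mapsto\langle h,\mathcal{I}(A)(a)k\rangle$ is a complex measure on $\mathcal{O}(X)$. For $h,k\in\mathcal{H}$ put $\mathcal{I}_{h,k}(A)(a)=\langle h,\mathcal{I}(A)(a)k\rangle$ for $A\in\mathcal{O}(X)$, $a\in\mathcal{A}$; then $\mathcal{I}_{h,k}:\mathcal{O}(X)\to\mathcal{A}^*$ is a (norm countably additive)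 $\mathcal{A}^*$-valued vector measure of bounded variation, where $\mathcal{A}^*$ is the Banach space dual of $\mathcal{A}$. A vector measure $\mu$ on $(X,\mathcal{O}(X))$ with values in a Banach space $\mathcal{B}$ is regular if for every Borel set $E\in\mathcal{O}(X)$ and every $\epsilon>0$ there are an open set $O$ containing $E$ and a compact set $C$ contained in $E$ such that $\|\mu(O\setminus C)\|<\epsilon$. The instrument $\mathcal{I}$ is regular if $\mathcal{I}_{h,k}$ is a regular $\mathcal{A}^*$-valued measure for all $h,k\in\mathcal{H}$. *)

(* Defs.v *)
From HB Require Import structures.
From mathcomp Require Import all_boot all_order all_algebra.
From mathcomp Require Import all_classical all_reals all_analysis.
From mathcomp.real_closed Require Import complex.
Set Implicit Arguments.
Unset Strict Implicit.
Unset Printing Implicit Defensive.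
Import Order.TTheory GRing.Theory Num.Theory.
Import numFieldNormedType.Exports.
Local Open Scope classical_set_scope.
Local Open Scope complex_scope.
Local Open Scope ring_scope.

HB.mixin Record isCompactHausdorff X & Topological X := {
  compact_space : compact [set: X];
  hausdorff : hausdorff_space X
}.
#[short(type="compactHausdorffType")]
HB.structure Definition CompactHausdorff :=
  {X of Topological X & isCompactHausdorff X}.

(* The inner product is anti-linear in its first argument. *)
HB.mixin Record isHilbert (R : realType) H & CompleteNormedModule R[i] H := {
  inner : H -> H -> R[i];
  innerPr : forall h a k l, inner h (a *: k + l) = a * inner h k + inner h l;
  inner_conj : forall h k, inner k h = (inner h k)^*;
  inner_norm : forall h, inner h h = `|h| ^+ 2
}.
#[short(type="hilbertType")]
HB.structure Definition Hilbert (R : realType) :=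
  {H of CompleteNormedModule R[i] H & isHilbert R H}.

(* Unital C*-algebras (the zero algebra included, as it is C(X, A) for X empty).
   The ring operations are fields of the mixin because Hierarchy-Builder admits
   no structure joining rings and normed modules below Num.NumDomain; the ring
   structure is recovered by the instance that follows. *)
HB.mixin Record isCStarAlgebra (R : realType) A
    & CompleteNormedModule R[i] A := {
  cone : A;
  cmul : A -> A -> A;
  cmulA : associative cmul;
  cmul1l : left_id cone cmul;
  cmul1r : right_id cone cmul;
  cmulDl : left_distributive cmul +%R;
  cmulDr : right_distributive cmul +%R;
  cscaleAl : forall (c : R[i]) (x y : A), c *: cmul x y = cmul (c *: x) y;
  cscaleAr : forall (c : R[i]) (x y : A), c *: cmul x y = cmul x (c *: y);
  star : A -> A;
  starP : forall (c : R[i]) (x y : A), star (c *: x + y) = c^* *: star x + star y;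
  starM : forall x y, star (cmul x y) = cmul (star y) (star x);
  starK : involutive star;
  cnormM : forall x y : A, `|cmul x y| <= `|x| * `|y|;
  cnorm_starM : forall x : A, `|cmul (star x) x| = `|x| ^+ 2
}.
#[short(type="cstarAlgType")]
HB.structure Definition CStarAlgebra (R : realType) :=
  {A of CompleteNormedModule R[i] A & isCStarAlgebra R A}.

#[non_forgetful_inheritance]
HB.instance Definition _ (R : realType) (A : cstarAlgType R) :=
  GRing.Zmodule_isPzRing.Build (CStarAlgebra.sort A)
    (@cmulA R A) (@cmul1l R A) (@cmul1r R A) (@cmulDl R A) (@cmulDr R A).


Section bounded_operators.
Context {R : realType} (H : hilbertType R).

Definition bounded_linear : {pred H -> H} := mem [set T : H -> H |
  linear T /\ exists M : R[i], forall h, `|T h| <= M * `|h|].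

Lemma bounded_linear_submod : submod_closed bounded_linear.
Proof.
split=> [|a S T].
  rewrite inE; split=> [b h k|]; first by rewrite -[LHS]/0 -[RHS]/(b *: 0 + 0) scaler0 addr0.
  by exists 0 => h; rewrite -[X in `|X|]/0 normr0 mul0r.
rewrite !inE => -[linS [M HM]] [linT [N HN]]; split=> [b h k|].
  rewrite !fctE linS linT !scalerDr !scalerA (mulrC a b).
  by rewrite addrACA.
exists (`|a| * M + N) => h; rewrite !fctE (le_trans (ler_normD _ _))//.
by rewrite mulrDl lerD// normrZ -mulrA ler_wpM2l.
Qed.

HB.instance Definition _ :=
  GRing.isSubmodClosed.Build R[i] (H -> H) bounded_linear bounded_linear_submod.

Record boundedOp := BoundedOp {
  bop_fun :> H -> H; _ : bop_fun \in bounded_linear }.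
HB.instance Definition _ := [isSub for bop_fun].
HB.instance Definition _ := [Choice of boundedOp by <:].
HB.instance Definition _ := [SubChoice_isSubLmodule of boundedOp by <:].

Lemma bop_linear (T : boundedOp) : linear T.
Proof. by have := valP T; rewrite inE => -[]. Qed.

HB.instance Definition _ (T : boundedOp) :=
  GRing.isLinear.Build R[i] H H *:%R (bop_fun T) (bop_linear T).

End bounded_operators.

Section cnorm.
Context {R : realType}.

(* Real-valued norm: the norm of a normedModType R[i] has values in R[i]. *)
Definition rnorm {V : normedModType R[i]} (v : V) : R := complex.Re `|v|.

Lemma rnormE {V : normedModType R[i]} (v : V) : (rnorm v)%:C = `|v|.
Proof. by rewrite /rnorm RRe_real// normr_real. Qed.

Lemma rnorm_ge0 {V : normedModType R[i]} (v : V) : 0 <= rnorm v.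
Proof. by rewrite -lecR rnormE; exact: normr_ge0. Qed.

Lemma rnorm_continuous {V : normedModType R[i]} :
  continuous (rnorm : V -> R).
Proof.
move=> v; apply/cvgrPdist_lt => e e0.
have vv : w @[w --> v] --> v by exact: cvg_id.
have e0' : 0 < e%:C :> R[i] by rewrite ltcR.
move/cvgrPdist_lt : vv => /(_ _ e0'); apply: filterS => w vw.
rewrite -ltcR (le_lt_trans _ vw)//.
have -> : `|rnorm v - rnorm w|%:C = `| `|v| - `|w| |.
  by rewrite -!rnormE -rmorphB/= normc_def/= expr0n/= addr0 sqrtr_sqr.
exact: ler_dist_dist.
Qed.

Lemma rnorm_bounded (X : compactHausdorffType) {V : normedModType R[i]}
  (f : X -> V) : continuous f -> has_ubound (range (fun x => rnorm (f x))).
Proof.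
move=> fc.
have gc : continuous (fun x => rnorm (f x)).
  by move=> x; exact: (continuous_comp (fc x) (@rnorm_continuous V (f x))).
have /compact_bounded[M [_ HM]] : compact (range (fun x => rnorm (f x))).
  by apply: continuous_compact (@compact_space X); apply: continuous_subspaceT.
exists (`|M| + 1) => y /= ry; apply: le_trans (ler_norm _) _.
apply: HM ry.
by rewrite (le_lt_trans (ler_norm M))// ltrDl.
Qed.
End cnorm.

Section continuous_functions.
Context {R : realType} {X : compactHausdorffType} {A : cstarAlgType R}.

(* The C*-algebra C(X, A): pointwise operations and supremum norm. *)
Definition cfun := continuousType X A.
HB.instance Definition _ := Choice.on cfun.

Definition cts : {pred X -> A} := mem [set f : X -> A | continuous f].

Definition cfun_of (f : X -> A) (fc : f \in cts) : cfun :=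
  mkcts (set_mem fc).

Lemma cfun_rect (K : cfun -> Type) :
  (forall f (fc : f \in cts), K (cfun_of fc)) -> forall u, K u.
Proof.
move=> Ku u; have uc : (u : X -> A) \in cts by rewrite inE; exact: cts_fun.
by have -> : u = cfun_of uc by apply/continuousEP.
Qed.

Lemma cfun_of_val f (fc : f \in cts) : cfun_of fc = f :> (X -> A).
Proof. by []. Qed.

HB.instance Definition _ := isSub.Build (X -> A) _ cfun cfun_rect cfun_of_val.

Lemma cts_submod : submod_closed cts.
Proof.
split=> [|a f g]; first by rewrite inE; exact: cst_continuous.
rewrite !inE => fc gc x; apply: cvgD; last exact: gc.
by apply: cvgZr; exact: fc.
Qed.
HB.instance Definition _ :=
  GRing.isSubmodClosed.Build R[i] (X -> A) cts cts_submod.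
HB.instance Definition _ := [SubChoice_isSubLmodule of cfun by <:].

Lemma cfunP (f g : cfun) : f =1 g -> f = g.
Proof. by move=> fg; apply/continuousEP. Qed.
Lemma cfunD (f g : cfun) x : (f + g) x = f x + g x. Proof. by []. Qed.
Lemma cfunB (f g : cfun) x : (f - g) x = f x - g x. Proof. by []. Qed.
Lemma cfunZ c (f : cfun) x : (c *: f) x = c *: f x. Proof. by []. Qed.
Lemma cfun0 x : (0 : cfun) x = 0. Proof. by []. Qed.

Definition sup_norm (f : cfun) : R[i] := (sup (range (fun x => rnorm (f x))))%:C.

Lemma sup_norm_ge (f : cfun) x : `|f x| <= sup_norm f.
Proof.
rewrite -rnormE lecR; apply: ub_le_sup; last by exists x.
by apply: rnorm_bounded; exact: cts_fun.
Qed.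

Lemma sup_norm_le (f : cfun) (M : R[i]) :
  0 <= M -> (forall x, `|f x| <= M) -> sup_norm f <= M.
Proof.
move=> M0 fM; rewrite -(RRe_real (ger0_real M0)) lecR.
have [[y ry]|/set0P/negP/negPn/eqP ->] := pselect (range (fun x => rnorm (f x)) !=set0).
  apply: ge_sup; first by exists y.
  by move=> _ [x _ <-]; rewrite -lecR rnormE RRe_real// ger0_real.
by rewrite sup0 -lecR RRe_real// ger0_real.
Qed.

Lemma sup_norm_ge0 (f : cfun) : 0 <= sup_norm f.
Proof.
rewrite -[0]/((0 : R)%:C) lecR.
have [[_ [x _ _]]|/set0P/negP/negPn/eqP ->] :=
  pselect (range (fun x => rnorm (f x)) !=set0); last by rewrite sup0.
by rewrite -lecR (le_trans _ (sup_norm_ge f x)).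
Qed.

Lemma sup_normD (f g : cfun) : sup_norm (f + g) <= sup_norm f + sup_norm g.
Proof.
apply: sup_norm_le => [|x]; first by rewrite addr_ge0// sup_norm_ge0.
by rewrite cfunD (le_trans (ler_normD _ _))// lerD// sup_norm_ge.
Qed.

Lemma sup_normZ (c : R[i]) (f : cfun) : sup_norm (c *: f) = `|c| * sup_norm f.
Proof.
have le d (g : cfun) : sup_norm (d *: g) <= `|d| * sup_norm g.
  apply: sup_norm_le => [|x]; first by rewrite mulr_ge0// sup_norm_ge0.
  by rewrite cfunZ normrZ ler_wpM2l// sup_norm_ge.
apply/eqP; rewrite eq_le le/=; have [->|c0] := eqVneq c 0.
  by rewrite normr0 mul0r sup_norm_ge0.
rewrite -{1}[f]scale1r -(mulVf c0) -scalerA.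
rewrite (le_trans (ler_wpM2l _ (le _ _)))// normfV mulrA divff ?mul1r//.
by rewrite normr_eq0.
Qed.

Lemma sup_norm0_eq0 (f : cfun) : sup_norm f = 0 -> f = 0.
Proof.
move=> f0; apply: cfunP => x; apply/eqP.
by rewrite -normr_le0 -f0 sup_norm_ge.
Qed.

HB.instance Definition _ :=
  Lmodule_isNormed.Build R[i] cfun sup_normD sup_normZ sup_norm0_eq0.

Lemma cfun_normE (f : cfun) : `|f| = sup_norm f. Proof. by []. Qed.

Lemma cfun_complete (F : set_system cfun) : ProperFilter F -> cauchy F -> cvg F.
Proof.
move=> FF Fc.
have Fex e : 0 < e -> exists2 f : cfun, F (ball f e) & True.
  by move=> e0; have /cauchyP/(_ _ e0)[f] := Fc; exists f.
have evc x : cvg ((fun f : cfun => f x) @ F).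
  apply: cauchy_cvg; apply: cauchy_exP => e e0.
  have [f Ff _] := Fex e e0; exists (f x).
  apply: (@filterS _ F _ (ball f e)) Ff => g.
  rewrite -!ball_normE/= => fg.
  apply: le_lt_trans fg; exact: (sup_norm_ge (f - g) x).
pose l x := lim ((fun f : cfun => f x) @ F).
have lF x : f x @[f --> F] --> l x by exact: evc.
have lB e f : F (ball f e) -> forall x, `|l x - f x| <= e.
  move=> Ff x; have [g0 fg0] := filter_ex Ff.
  have e0 : 0 < e by move: fg0; rewrite -ball_normE/=; exact: le_lt_trans.
  apply/ler_addgt0Pr => d d0.
  have /filter_ex[g [fg lg]] : F [set g : cfun | ball f e g /\ `|l x - g x| < d].
    by apply: filterI Ff _; move/cvgrPdist_lt : (lF x) => /(_ _ d0).
  move: fg; rewrite -ball_normE/= => fg.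
  rewrite -(subrKA (g x)) (le_trans (ler_normD _ _))// addrC lerD ?ltW//.
  rewrite distrC; apply: le_lt_trans fg; exact: (sup_norm_ge (f - g) x).
have lc : continuous l.
  move=> x; apply/cvgrPdist_lt => e e0.
  have e3 : 0 < e / 3%:R by rewrite divr_gt0.
  have [f Ff _] := Fex _ e3.
  have /cvgrPdist_lt/(_ _ e3) := @cts_fun _ _ f x.
  apply: filterS => y fxy.
  rewrite -(subrKA (f x)) -[f x - l y](subrKA (f y)).
  rewrite (le_lt_trans (ler_normD _ _))//.
  rewrite (_ : e = e / 3%:R + (e / 3%:R + e / 3%:R)); last first.
    by rewrite -[LHS](@divfK _ 3%:R) ?pnatr_eq0// mulr_natr mulrS mulr2n.
  rewrite ler_ltD ?lB// (le_lt_trans (ler_normD _ _))// ltr_leD//.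
  by rewrite distrC lB.
pose L : cfun := mkcts lc.
apply/cvg_ex; exists L.
suff : id @ F --> L by [].
apply/cvgrPdist_le => e e0.
have [f Ff _] := Fex _ (divr_gt0 e0 (ltr0Sn _ 1)).
have lBf := lB _ _ Ff; apply: filterS Ff => g fg.
rewrite cfun_normE; apply: sup_norm_le => [|x]; first exact: ltW.
rewrite cfunB -(subrKA (f x)) (le_trans (ler_normD _ _))// [e]splitr lerD//.
move: fg; rewrite -ball_normE/= => fg.
by apply: le_trans (sup_norm_ge (f - g) x) _; exact: ltW.
Qed.

HB.instance Definition _ := Uniform_isComplete.Build cfun cfun_complete.

Definition cfun_one : cfun := cst 1.

Definition cfun_star_fun (f : cfun) (x : X) : A := star (f x).

Lemma norm_star (a : A) : `|star a| = `|a|.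
Proof.
have le (b : A) : `|b| <= `|star b|.
  have [->|b0] := eqVneq b 0; first by rewrite normr0.
  rewrite -(ler_pM2r (_ : 0 < `|b|)) ?normr_gt0// -expr2 -cnorm_starM.
  exact: cnormM.
by apply/eqP; rewrite eq_le le -{2}[a]starK le.
Qed.

Lemma starB (a b : A) : star (a - b) = star a - star b.
Proof.
by rewrite addrC -scaleN1r starP rmorphN rmorph1 scaleN1r addrC.
Qed.

Lemma cfun_star_continuous (f : cfun) : continuous (cfun_star_fun f).
Proof.
move=> x; apply/cvgrPdist_lt => e e0.
have /cvgrPdist_lt/(_ _ e0) := @cts_fun _ _ f x.
by apply: filterS => y; rewrite -starB norm_star.
Qed.

Definition cfun_star (f : cfun) : cfun := mkcts (@cfun_star_continuous f).

Lemma cfun_mul_continuous (f g : cfun) : continuous (fun x => f x * g x).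
Proof.
move=> x; apply/cvgrPdist_lt => e e0.
pose M := `|f| + `|g| + 1.
have M0 : 0 < M by rewrite ltr_wpDl// addr_ge0.
have d0 : 0 < e / M by rewrite divr_gt0.
have /cvgrPdist_lt/(_ _ d0) fx := @cts_fun _ _ f x.
have /cvgrPdist_lt/(_ _ d0) gx := @cts_fun _ _ g x.
apply: filterS2 fx gx => y fxy gxy.
have -> : f x * g x - f y * g y = (f x - f y) * g x + f y * (g x - g y).
  by rewrite mulrBl mulrBr addrA subrK.
rewrite (le_lt_trans (ler_normD _ _))//.
apply: (@le_lt_trans _ _ (e / M * (`|g| + `|f|))).
  rewrite [e / M * _]mulrDr lerD// (le_trans (cnormM _ _))//.
    by rewrite ler_pM ?(ltW fxy)//; exact: sup_norm_ge.
  by rewrite mulrC ler_pM ?(ltW gxy)//; exact: sup_norm_ge.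
by rewrite mulrAC ltr_pdivrMr// ltr_pM2l// addrC ltrDl.
Qed.

Definition cfun_mul (f g : cfun) : cfun := mkcts (@cfun_mul_continuous f g).

Lemma cfun_mulA : associative cfun_mul.
Proof. by move=> f g h; apply: cfunP => x; exact: mulrA. Qed.
Lemma cfun_mul1l : left_id cfun_one cfun_mul.
Proof. by move=> f; apply: cfunP => x; exact: mul1r. Qed.
Lemma cfun_mul1r : right_id cfun_one cfun_mul.
Proof. by move=> f; apply: cfunP => x; exact: mulr1. Qed.
Lemma cfun_mulDl : left_distributive cfun_mul +%R.
Proof. by move=> f g h; apply: cfunP => x; exact: mulrDl. Qed.
Lemma cfun_mulDr : right_distributive cfun_mul +%R.
Proof. by move=> f g h; apply: cfunP => x; exact: mulrDr. Qed.
Lemma cfun_scaleAl (c : R[i]) f g : c *: cfun_mul f g = cfun_mul (c *: f) g.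
Proof. by apply: cfunP => x; exact: cscaleAl. Qed.
Lemma cfun_scaleAr (c : R[i]) f g : c *: cfun_mul f g = cfun_mul f (c *: g).
Proof. by apply: cfunP => x; exact: cscaleAr. Qed.
Lemma cfun_starP (c : R[i]) f g :
  cfun_star (c *: f + g) = c^* *: cfun_star f + cfun_star g.
Proof. by apply: cfunP => x; exact: starP. Qed.
Lemma cfun_starM f g :
  cfun_star (cfun_mul f g) = cfun_mul (cfun_star g) (cfun_star f).
Proof. by apply: cfunP => x; exact: starM. Qed.
Lemma cfun_starK : involutive cfun_star.
Proof. by move=> f; apply: cfunP => x; exact: starK. Qed.

Lemma cfun_normM (f g : cfun) : `|cfun_mul f g| <= `|f| * `|g|.
Proof.
apply: sup_norm_le => [|x]; first by rewrite mulr_ge0.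
apply: le_trans (cnormM _ _) _.
by rewrite ler_pM//; exact: sup_norm_ge.
Qed.

Lemma cfun_norm_starM (f : cfun) : `|cfun_mul (cfun_star f) f| = `|f| ^+ 2.
Proof.
apply/eqP; rewrite eq_le; apply/andP; split.
  apply: sup_norm_le => [|x]; first by rewrite exprn_ge0.
  rewrite [X in `|X|](_ : _ = star (f x) * f x)// cnorm_starM.
  by rewrite ler_sqr ?nnegrE//; exact: sup_norm_ge.
pose s := sqrtC `|cfun_mul (cfun_star f) f|.
have s0 : 0 <= s by rewrite sqrtC_ge0.
rewrite -[leRHS]sqrtCK -/s ler_sqr ?nnegrE//.
apply: sup_norm_le => // x.
rewrite -ler_sqr ?nnegrE// sqrtCK -cnorm_starM.
exact: (sup_norm_ge (cfun_mul (cfun_star f) f) x).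
Qed.

HB.instance Definition _ := isCStarAlgebra.Build R cfun
  cfun_mulA cfun_mul1l cfun_mul1r cfun_mulDl cfun_mulDr
  cfun_scaleAl cfun_scaleAr cfun_starP cfun_starM cfun_starK
  cfun_normM cfun_norm_starM.

End continuous_functions.
Arguments cfun {R} X A.


Section borel_sets.
Context {X : topologicalType}.

Record borelSet := BorelSet {
  borel_set :> set X;
  borelP : <<s @open X >> borel_set }.

Lemma borel_subproofD (E F : borelSet) : <<s @open X >> (E `\` F).
Proof.
have bC G : <<s @open X >> G -> <<s @open X >> (~` G).
  by move=> bG; rewrite -setTD; exact: sigma_algebraCD.
rewrite setDE -[E : set X]setCK -setCU -bigcup2E; apply: (bC).
apply: sigma_algebra_bigcup => -[|[|i]] /=.
- exact: (bC _ (borelP E)).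
- exact: borelP.
- exact: sigma_algebra0.
Qed.

Definition borelD (E F : borelSet) := BorelSet (borel_subproofD E F).

End borel_sets.
Arguments borelSet X : clear implicits.

Section completely_positive.
Context {R : realType} {A : cstarAlgType R} {H : hilbertType R}.

(* M_n(A) with its *-algebra structure; its positive elements are the N^* N. *)
Definition star_mx n (M : 'M[A]_n) : 'M[A]_n := \matrix_(i, j) star (M j i).

Definition positive_mx n (M : 'M[A]_n) := exists N, M = star_mx N *m N.

(* Positivity of the matrix as an operator on the Hilbert space H^n. *)
Definition positive_opmx n (T : 'M[boundedOp H]_n) :=
  forall h : 'I_n -> H,
    0 <= \sum_(i < n) inner (h i) (\sum_(j < n) T i j (h j)).

Definition completely_positive (Phi : A -> boundedOp H) :=
  forall n (M : 'M[A]_n), positive_mx M -> positive_opmx (map_mx Phi M).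

End completely_positive.

Record CPmap (R : realType) (A : cstarAlgType R) (H : hilbertType R) := {
  cp_fun :> {linear A -> boundedOp H};
  cp_positive : completely_positive cp_fun }.

Section vector_measures.
Context {R : realType} {X : topologicalType}.

Definition complex_measure (mu : borelSet X -> R[i]) :=
  forall (F : nat -> borelSet X) (E : borelSet X),
    trivIset setT (fun n => F n : set X) ->
    E = \bigcup_n (F n : set X) :> set X ->
    (fun n => \sum_(i < n) mu (F i) : R[i]^o) @ \oo --> (mu E : R[i]^o).

Definition regular_measure {V : Type} (nrm : V -> \bar R)
    (mu : borelSet X -> V) :=
  forall (E : borelSet X) (e : R), 0 < e ->
    exists O C : borelSet X,
      [/\ open O, E `<=` O, compact C, C `<=` E &
          (nrm (mu (borelD O C)) < e%:E)%E].

Context {A : cstarAlgType R}.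

(* The norm of A^*; it is +oo on functionals that are not bounded. *)
Definition dual_norm (phi : A -> R[i]) : \bar R :=
  ereal_sup [set (complex.Re `|phi a|)%:E | a in [set a : A | `|a| <= 1]].

(* v is the integral of the A-valued function f against the A^*-valued vector
   measure mu: the integrals of the simple functions \sum_i a_i 1_(E_i), that
   is \sum_i mu(E_i)(a_i), tend to v when these functions tend to f uniformly. *)
Definition is_integral (mu : borelSet X -> A -> R[i]) (f : X -> A) (v : R[i]) :=
  forall e : R[i], 0 < e -> exists2 d : R[i], 0 < d &
    forall n (E : 'I_n -> borelSet X) (a : 'I_n -> A),
      trivIset setT (fun i => E i : set X) ->
      \bigcup_i (E i : set X) = setT ->
      (forall i x, (E i : set X) x -> `|f x - a i| <= d) ->
      `|v - \sum_(i < n) mu (E i) (a i)| <= e.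

End vector_measures.

Section instruments.
Context {R : realType} {X : topologicalType} {A : cstarAlgType R}
  {H : hilbertType R}.
Implicit Type I : borelSet X -> CPmap A H.

Definition matrix_elem I (h k : H) (E : borelSet X) (a : A) : R[i] :=
  inner h (I E a k).

Definition cp_instrument I :=
  forall h k a, complex_measure (fun E => matrix_elem I h k E a).

Definition regular_instrument I :=
  forall h k, regular_measure dual_norm (matrix_elem I h k).

End instruments.

Record regularCPInstrument (R : realType) (X : topologicalType)
    (A : cstarAlgType R) (H : hilbertType R) := {
  instr :> borelSet X -> CPmap A H;
  instr_measure : cp_instrument instr;
  instr_regular : regular_instrument instr }.

(* Main.v *)
Require Import Defs.
From HB Require Import structures.
From mathcomp Require Import all_boot all_order all_algebra.
From mathcomp Require Import all_classical all_reals all_analysis.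
From mathcomp.real_closed Require Import complex.
From mathcomp Require Import ring lra.

(** An instrument I gives Phi(f) = int f dI, and the inverse of I |-> Phi is an
    operator-valued Riesz-Markov theorem. Everything rests on two inequalities
    for a completely positive Phi. The first is the Schwarz inequality
    2 Re <h, Phi(b^* a) k> <= <h, Phi(b^* b) h> + <k, Phi(a^* a) k>
    (cp_schwarz), from positivity on 2 x 2 matrices; its additive form can be
    summed over the cells of a partition. The second is
    Phi(a^* a) <= |a|^2 Phi(1) (cp_starM_le), which needs a square root of
    1 - x for x self-adjoint with |x| < 1 (cstar_sqrt, a fixed point argument).
    Together they give 2 Re <h, Phi(a) k> <= |a| (q(h) + q(k)) with
    q(h) = <h, Phi(1) h> (cp_le): the positive scalar measures
    q_h(E) = <h, I(E)(1) h> dominate the instrument.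

    From I to Phi. By cp_le, Riemann sums over two partitions on whose cells f
    oscillates little are close, uniformly on bounded sets of vectors
    (riemann_dist). So they form a strongly Cauchy net of completely positive
    maps along the refinement of tagged partitions, and strong limits of
    bounded nets of completely positive maps are completely positive (cp_lim).

    From Phi to I. For each vector k, g |-> <k, Phi(g) k> is a positive
    functional on C(X). The Borel sets E that lie between a closed C and an open
    U with U \ C of small mass, for this functional, form a sigma-algebra
    containing the open sets (tight_borel).
    By the Schwarz inequality Phi(g f) k is controlled by the L^2 norm of g for
    k (mass_bound), hence converges when g runs through the continuous cut-offs
    between C and U. The limit, Phi(1_E f) k, is completely positive in f by
    cp_lim (exists_extension), additive (extensionU) and countably additive
    (extension_tail, extension_instrument) in E; its restriction to constant
    functions f is the instrument.

    Finally I is determined by Phi: for a regular instrument,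
    <h, I(E)(a) k> is close to <h, Phi(g a) k> for every g between C and U, where
    q_h(U \ C) and q_k(U \ C) are small (integral_between). *)

Set Implicit Arguments.
Unset Strict Implicit.
Unset Printing Implicit Defensive.
Import Order.TTheory GRing.Theory Num.Theory.
Import numFieldNormedType.Exports.
Local Open Scope classical_set_scope.
Local Open Scope complex_scope.
Local Open Scope ring_scope.

(** * Real-valued norms and inner products *)

Section complex_facts.
Context {R : realType}.
Implicit Types (z : R[i]) (t : R).

Lemma Re_mulC t z : complex.Re (t%:C * z) = t * complex.Re z.
Proof. by case: z => a b /=; rewrite mul0r subr0. Qed.

Lemma Im_Re z : complex.Im z = - complex.Re ('i%C * z).
Proof. by case: z => a b /=; rewrite mul0r mul1r sub0r opprK. Qed.

Lemma complexReD z1 z2 : complex.Re (z1 + z2) = complex.Re z1 + complex.Re z2.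
Proof. by case: z1; case: z2. Qed.

Lemma ReJ z : complex.Re z^* = complex.Re z.
Proof. by case: z. Qed.

Lemma unimodular z : exists2 u : R[i], `|u| = 1 & u * z = `|z|.
Proof.
have [->|z0] := eqVneq z 0; first by exists 1; rewrite ?normr1// mulr0 normr0.
exists (z^* / `|z|).
  by rewrite normf_div normcJ normr_id divff// normr_eq0.
by rewrite mulrAC [_ * z]mulrC -sqr_normc expr2 mulfK// normr_eq0.
Qed.

(** Bounds on real parts that are invariant under rotations are bounds on the
    modulus. *)
Lemma norm_le_Re z t : (forall u : R[i], `|u| = 1 -> complex.Re (u * z) <= t) ->
  `|z| <= t%:C.
Proof.
move=> zt; have [u u1 uz] := unimodular z.
have := zt _ u1; rewrite uz -lecR RRe_real//; exact: normr_real.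
Qed.

End complex_facts.

Section normed.
Context {R : realType} {V : normedModType R[i]}.
Implicit Types (v w : V) (t : R).

Lemma rnorm0 : rnorm (0 : V) = 0.
Proof. by rewrite /rnorm normr0. Qed.

Lemma rnorm_eq0 v : (rnorm v == 0) = (v == 0).
Proof. by rewrite -(normr_eq0 v) -rnormE eq_complex/= eqxx andbT. Qed.

Lemma rnormN v : rnorm (- v) = rnorm v.
Proof. by rewrite /rnorm normrN. Qed.

Lemma rdistC v w : rnorm (v - w) = rnorm (w - v).
Proof. by rewrite /rnorm distrC. Qed.

Lemma rnormD v w : rnorm (v + w) <= rnorm v + rnorm w.
Proof. by rewrite -lecR rmorphD/= !rnormE ler_normD. Qed.

Lemma rnormZ t v : rnorm (t%:C *: v) = `|t| * rnorm v.
Proof.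
apply: complexI; rewrite rmorphM/= !rnormE normrZ; congr (_ * _).
by rewrite normc_def/= expr0n addr0 sqrtr_sqr.
Qed.

Lemma rnorm_le v t : (rnorm v <= t) = (`|v| <= t%:C).
Proof. by rewrite -lecR rnormE. Qed.

Lemma rnorm_lt v t : (rnorm v < t) = (`|v| < t%:C).
Proof. by rewrite -ltcR rnormE. Qed.

Lemma cvg_rnormP (T : Type) (F : set_system T) (FF : Filter F) (u : T -> V) v :
  (forall e, 0 < e -> \forall t \near F, rnorm (v - u t) < e) <->
  u t @[t --> F] --> v.
Proof.
split=> [uv|/cvgrPdist_lt uv e e0].
  apply/cvgrPdist_lt => -[e e'] /[dup]; rewrite {1}ltcE/= => /andP[/eqP -> e0 _].
  by apply: filterS (uv _ e0) => t; rewrite rnorm_lt.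
have /uv : 0 < e%:C by rewrite ltcR.
by apply: filterS => t; rewrite rnorm_lt.
Qed.

Lemma rnorm_cvg (T : Type) (F : set_system T) (FF : Filter F) (u : T -> V) v :
  u t @[t --> F] --> v -> rnorm (u t) @[t --> F] --> rnorm v.
Proof. by move=> uv; apply: (cvg_comp _ _ uv); exact: rnorm_continuous. Qed.

End normed.

Lemma cvg_cauchy_rnorm {R : realType} {V : completeNormedModType R[i]}
    (T : Type) (F : set_system T) (FF : ProperFilter F) (u : T -> V) :
  (forall e : R, 0 < e -> exists2 P : set T, F P &
    forall s t, P s -> P t -> rnorm (u s - u t) < e) ->
  cvg (u t @[t --> F]).
Proof.
move=> uc; apply: cauchy_cvg; apply: cauchy_exP => -[e e'] /[dup].
rewrite {1}ltcE/= => /andP[/eqP -> e0] _.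
have [P FP Pe] := uc _ e0; have [s Ps] := filter_ex FP.
exists (u s); apply: filterS FP => t Pt.
by rewrite -ball_normE/= -rnorm_lt Pe.
Qed.

Section hilbert.
Context {R : realType} {H : hilbertType R}.
Implicit Types (h k l : H) (t : R).

Lemma innerDr h k l : inner h (k + l) = inner h k + inner h l.
Proof. by rewrite -[k in LHS]scale1r innerPr mul1r. Qed.

Lemma inner0r h : inner h (0 : H) = 0.
Proof. by apply: (addIr (inner h 0)); rewrite -innerDr addr0 add0r. Qed.

Lemma innerZr h (c : R[i]) k : inner h (c *: k) = c * inner h k.
Proof. by rewrite -[c *: k]addr0 innerPr inner0r addr0. Qed.

Lemma innerZl h (c : R[i]) k : inner (c *: h) k = c^* * inner h k.
Proof. by rewrite inner_conj innerZr rmorphM/= -inner_conj. Qed.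

Lemma inner_sumr h (I : Type) (r : seq I) (P : pred I) (u : I -> H) :
  inner h (\sum_(i <- r | P i) u i) = \sum_(i <- r | P i) inner h (u i).
Proof. by apply: (big_morph _ (innerDr h)); exact: inner0r. Qed.

(** Estimates are made on real parts, where the order is total; replacing h by
    its unimodular multiples recovers the modulus of the inner product. *)
Definition ip h k : R := complex.Re (inner h k).

Lemma ipC h k : ip h k = ip k h.
Proof. by rewrite /ip inner_conj ReJ. Qed.

Lemma ipDr h k l : ip h (k + l) = ip h k + ip h l.
Proof. by rewrite /ip innerDr complexReD. Qed.

Lemma ipZr h t k : ip h (t%:C *: k) = t * ip h k.
Proof. by rewrite /ip innerZr Re_mulC. Qed.

Lemma ipZl h t k : ip (t%:C *: h) k = t * ip h k.
Proof. by rewrite ipC ipZr ipC. Qed.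

Lemma ip0r h : ip h 0 = 0.
Proof. by rewrite /ip inner0r. Qed.

Lemma ipNr h k : ip h (- k) = - ip h k.
Proof. by apply/eqP; rewrite -addr_eq0 -ipDr addNr ip0r. Qed.

Lemma ipBr h k l : ip h (k - l) = ip h k - ip h l.
Proof. by rewrite ipDr ipNr. Qed.

Lemma ip_sumr h (I : Type) (r : seq I) (P : pred I) (u : I -> H) :
  ip h (\sum_(i <- r | P i) u i) = \sum_(i <- r | P i) ip h (u i).
Proof. by apply: (big_morph _ (ipDr h)); exact: ip0r. Qed.

Lemma ipDl h k l : ip (h + k) l = ip h l + ip k l.
Proof. by rewrite ipC ipDr !(ipC l). Qed.

Lemma ipp h : ip h h = rnorm h ^+ 2.
Proof. by rewrite /ip inner_norm -rnormE -rmorphXn. Qed.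

(** Squaring the triangle inequality of the norm of H gives the Cauchy-Schwarz
    inequality. *)
Lemma ip_le h k : ip h k <= rnorm h * rnorm k.
Proof.
have : rnorm (h + k) ^+ 2 <= (rnorm h + rnorm k) ^+ 2.
  by rewrite ler_sqr ?nnegrE ?addr_ge0 ?rnorm_ge0// rnormD.
rewrite -ipp ipDr !ipDl !ipp (ipC k); nra.
Qed.

Lemma ip_cvg (T : Type) (F : set_system T) (FF : Filter F) (u : T -> H) h k :
  u t @[t --> F] --> k -> ip h (u t) @[t --> F] --> ip h k.
Proof.
move=> /cvg_rnormP uk; apply/cvgrPdist_lt => e e0.
have M0 : 0 < rnorm h + 1 by rewrite ltr_wpDl// rnorm_ge0.
have := uk _ (divr_gt0 e0 M0); apply: filterS => t; rewrite ltr_pdivlMr// => ut.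
have le v : rnorm v = rnorm (k - u t) -> ip h v < e.
  move=> vu; rewrite (le_lt_trans (ip_le _ _))// (le_lt_trans _ ut)// vu mulrC.
  by rewrite ler_wpM2l ?rnorm_ge0// lerDl.
by rewrite -ipBr real_ltr_norml ?num_real// ltrNl -ipNr !le// rnormN.
Qed.

Lemma inner_ImE h k : complex.Im (inner h k) = - ip h ('i%C *: k).
Proof. by rewrite Im_Re /ip innerZr. Qed.

(** The hypothesis at h = v / M, where it is strongest. *)
Lemma rnorm_sqr_le (v : H) (M c : R) : 0 < M ->
  (forall h, 2 * ip h v <= M * rnorm h ^+ 2 + c) -> rnorm v ^+ 2 <= M * c.
Proof.
move=> M0 /(_ (M^-1%:C *: v)).
rewrite ipZl ipp rnormZ exprMn gtr0_norm ?invr_gt0//.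
rewrite exprVn expr2 invfM -mulrA mulVKf ?gt_eqF// => vM.
have : M^-1 * rnorm v ^+ 2 <= c by lra.
by rewrite mulrC ler_pdivrMr// mulrC.
Qed.

Lemma ip_eq (v w : H) : (forall h, ip h v = ip h w) -> v = w.
Proof.
move=> vw; apply/eqP; rewrite -subr_eq0 -rnorm_eq0 -sqrf_eq0 -ipp ipBr vw.
by rewrite subrr.
Qed.

Lemma inner_ge0P h k :
  0 <= inner h k <-> 0 <= ip h k /\ ip h ('i%C *: k) = 0.
Proof.
rewrite lecE inner_ImE oppr_eq0; split=> [/andP[/eqP ? ?]//|[? ->]].
by rewrite eqxx.
Qed.

End hilbert.

(** * Square roots in C*-algebras *)

Section cstar.
Context {R : realType} {A : cstarAlgType R}.
Implicit Types (x y a b : A) (t : R).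

Lemma starMr x y : star (x * y) = star y * star x.
Proof. exact: starM. Qed.

Lemma star1 : star (1 : A) = 1.
Proof.
by rewrite -{2}[1]starK -{2}[star 1]mulr1 starMr starK mulr1.
Qed.

Lemma star0 : star (0 : A) = 0.
Proof. by rewrite -[X in star X](subrr (0 : A)) starB subrr. Qed.

Lemma starZ (c : R[i]) x : star (c *: x) = c^* *: star x.
Proof. by rewrite -[c *: x]addr0 starP star0 addr0. Qed.

Lemma starZr t x : star (t%:C *: x) = t%:C *: star x.
Proof. by rewrite starZ; congr (_ *: _); exact: conjc_real. Qed.

Lemma starD x y : star (x + y) = star x + star y.
Proof. by rewrite -[x in LHS]scale1r starP rmorph1 scale1r. Qed.

Lemma rnorm_star x : rnorm (star x) = rnorm x.
Proof. by rewrite /rnorm norm_star. Qed.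

Lemma rnormM x y : rnorm (x * y) <= rnorm x * rnorm y.
Proof. by rewrite -lecR rmorphM/= !rnormE cnormM. Qed.

Lemma rnorm_starM x : rnorm (star x * x) = rnorm x ^+ 2.
Proof.
apply: (@complexI R); rewrite [LHS]rnormE [LHS]cnorm_starM -rnormE.
by rewrite -rmorphXn.
Qed.

Lemma rnorm1_le1 : rnorm (1 : A) <= 1.
Proof.
have := rnorm_starM 1; rewrite star1 mulr1.
have := rnorm_ge0 (1 : A); nra.
Qed.

Section square_root.
Variables (x : A) (xsa : star x = x) (x1 : rnorm x < 1).
Let r := rnorm x.
Let r0 : 0 <= r := rnorm_ge0 x.
Let F (y : A) : A := (2^-1 : R)%:C *: (x + y * y).
Let y n := iter n F 0.

Let F_dist u v : rnorm u <= r -> rnorm v <= r ->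
  rnorm (F u - F v) <= r * rnorm (u - v).
Proof.
move=> ur vr; rewrite /F -scalerBr rnormZ gtr0_norm ?invr_gt0//.
have -> : x + u * u - (x + v * v) = u * (u - v) + (u - v) * v.
  by rewrite opprD addrACA subrr add0r mulrBr mulrBl addrA subrK.
have := rnormD (u * (u - v)) ((u - v) * v).
have := rnormM u (u - v); have := rnormM (u - v) v.
have := rnorm_ge0 (u - v); nra.
Qed.

Let y_le n : rnorm (y n) <= r.
Proof.
elim: n => [|n IH]; first by rewrite rnorm0.
rewrite /= -/(y n) /F rnormZ gtr0_norm ?invr_gt0//.
have := rnormD x (y n * y n); have := rnormM (y n) (y n).
have := rnorm_ge0 (y n); rewrite -/r.
move: IH x1 r0; rewrite -/r; nra.
Qed.

Let y_star n : star (y n) = y n.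
Proof.
elim: n => [|n IH]; first exact: star0.
by rewrite /= -/(y n) /F starZr starD xsa starMr IH.
Qed.

(* All iterates lie in the ball, so iterating the contraction n times from
   y m and 0 bounds the distance without summing a geometric series. *)
Let y_dist n m : rnorm (y (n + m)%N - y n) <= r ^+ n.
Proof.
elim: n => [|n IH]; first by rewrite subr0 expr0 (le_trans (y_le m))// ltW.
rewrite exprS; apply: (le_trans (F_dist (y_le _) (y_le n))).
by rewrite ler_wpM2l.
Qed.

(** The square root is 1 - y, where y is the fixed point of
    y |-> (x + y ^+ 2) / 2. With r the norm of x, this map sends the ball of
    radius r to itself because (r + r ^+ 2) / 2 <= r, and is a contraction of
    ratio r there. The iterates from 0 are self-adjoint, hence so is y. *)
Lemma cstar_sqrt : exists2 b, star b = b & b * b = 1 - x.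
Proof.
have yc : cvg (y n @[n --> \oo]).
  apply: cvg_cauchy_rnorm => e e0.
  have e2 : 0 < e / 2 by rewrite divr_gt0.
  have : (fun n => r ^+ n) @ \oo --> (0 : R).
    by apply: cvg_expr; rewrite ger0_norm.
  move/cvgrPdist_lt => /(_ _ e2) [n _ nr].
  have {}nr : r ^+ n < e / 2.
    by have := nr n (leqnn n); rewrite /= sub0r normrN ger0_norm// exprn_ge0.
  exists [set m | (n <= m)%N]; first by exists n.
  have near_n m : (n <= m)%N -> rnorm (y m - y n) < e / 2.
    by move=> /subnKC <-; rewrite (le_lt_trans (y_dist _ _)).
  move=> i j ni nj; rewrite -(subrKA (y n)) (le_lt_trans (rnormD _ _))//.
  by rewrite [e]splitr ltrD ?near_n// rdistC near_n.
pose p := lim (y n @[n --> \oo]).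
have yp : y n @[n --> \oo] --> p by exact: yc.
have pr : rnorm p <= r.
  apply: (@cvgr_to_le _ \oo _ _ (fun n => rnorm (y n))); last exact: nearW y_le.
  by apply: rnorm_cvg.
have near_p e : 0 < e -> exists n, rnorm (p - y n) < e /\ rnorm (p - y n.+1) < e.
  move=> e0; have /cvg_rnormP := yp => /(_ _ e0) [n _ np].
  by exists n; split; apply: np => /=.
have fix_p : F p = p.
  apply/eqP; rewrite -subr_eq0 -rnorm_eq0 eq_le rnorm_ge0 andbT.
  apply/ler_addgt0Pr => e e0; have e2 : 0 < e / 2 by rewrite divr_gt0.
  have [n [pn pn1]] := near_p _ e2.
  rewrite -(subrKA (y n.+1)) (le_trans (rnormD _ _))// add0r [e]splitr.
  rewrite lerD// 1?rdistC ?ltW//.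
  apply: le_lt_trans (F_dist (y_le n) pr) _; rewrite rdistC.
  by rewrite (le_lt_trans _ pn)// ler_piMl ?rnorm_ge0// ltW.
have star_p : star p = p.
  apply/eqP; rewrite -subr_eq0 -rnorm_eq0 eq_le rnorm_ge0 andbT.
  apply/ler_addgt0Pr => e e0; have e2 : 0 < e / 2 by rewrite divr_gt0.
  have [n [pn _]] := near_p _ e2.
  rewrite -(subrKA (y n)) (le_trans (rnormD _ _))// add0r [e]splitr.
  by rewrite lerD// 1?rdistC ?ltW// -[y n]y_star -starB rnorm_star rdistC.
exists (1 - p); first by rewrite starB star1 star_p.
have : x + p * p = p + p.
  rewrite -{3 4}fix_p /F -scalerDl -rmorphD/= -[X in _%:C *: X]/(x + p * p).
  have -> : 2^-1 + 2^-1 = 1 :> R by lra.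
  by rewrite scale1r.
by move=> xpp; rewrite mulrBl mul1r mulrBr mulr1 -addrA -opprD addrA -xpp addrK.
Qed.
End square_root.
End cstar.

(** * Inequalities for completely positive maps *)

Section cp_maps.
Context {R : realType} {A : cstarAlgType R} {H : hilbertType R}.
Implicit Types (a b : A) (h k : H) (Phi : CPmap A H).

Lemma bopE_sum (I : Type) (r : seq I) (P : pred I) (T : I -> boundedOp H) h :
  (\sum_(i <- r | P i) T i) h = \sum_(i <- r | P i) T i h.
Proof. by elim/big_rec2: _ => // i S k _ <-. Qed.

Lemma bop_eq (S T : boundedOp H) : S =1 T -> S = T.
Proof. by move=> ST; apply: val_inj; apply/funext. Qed.

(** Complete positivity without matrices: N^* N is the sum, over the rows c of
    N, of the matrices (c_i^* c_j), so positivity on these suffices. *)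
Definition cp_form (Phi : A -> boundedOp H) :=
  forall n (c : 'I_n -> A) (h : 'I_n -> H),
    0 <= \sum_i inner (h i) (\sum_j Phi (star (c i) * c j) (h j)).

Lemma cp_formP (Phi : {linear A -> boundedOp H}) :
  completely_positive Phi <-> cp_form Phi.
Proof.
split=> [cpPhi [|n] c h|cpPhi n M [N ->] h]; first by rewrite big_ord0.
  (* a single nonzero row c *)
  pose N : 'M[A]_n.+1 := \matrix_(i, j) if i == ord0 then c j else 0.
  have := cpPhi _ _ (ex_intro _ N erefl) h.
  congr (0 <= _); apply: eq_bigr => i _; congr (inner _ _).
  apply: eq_bigr => j _; rewrite !mxE (bigD1 ord0)//= big1 ?addr0 ?mxE//.
  by move=> l l0; rewrite !mxE (negbTE l0) mulr0.
rewrite [leRHS](_ : _ = \sum_l \sum_i inner (h i)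
    (\sum_j Phi (star (N l i) * N l j) (h j))).
  by apply: sumr_ge0 => l _; exact: cpPhi.
rewrite exchange_big/=; apply: eq_bigr => i _.
rewrite -inner_sumr; congr (inner _ _); rewrite exchange_big/=.
apply: eq_bigr => j _; rewrite !mxE linear_sum bopE_sum.
by apply: eq_bigr => l _; rewrite !mxE.
Qed.

(** The bound M of a bounded operator is a complex number, whose real part need
    not be positive if H is zero. *)
Lemma bounded_op_bound (T : boundedOp H) :
  exists2 M : R, 0 < M & forall h, rnorm (T h) <= M * rnorm h.
Proof.
have [_ [M TM]] := set_mem (valP T); exists (`|complex.Re M| + 1).
  by rewrite ltr_wpDl.
move=> h; have := TM h; rewrite lecE => /andP[_].
rewrite -(rnormE h) mulrC Re_mulC -/(rnorm _) => /le_trans; apply.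
by rewrite mulrC ler_wpM2r ?rnorm_ge0// (le_trans (ler_norm _))// lerDl.
Qed.

Lemma cp_inner_ge0 Phi a h : 0 <= inner h (Phi (star a * a) h).
Proof.
have /cp_formP/(_ 1%N (fun=> a) (fun=> h)) := cp_positive Phi.
by rewrite !big_ord1.
Qed.

Lemma cp_ip_ge0 Phi a h : 0 <= ip h (Phi (star a * a) h).
Proof. by have /inner_ge0P[] := cp_inner_ge0 Phi a h. Qed.

Lemma cp_two_positive Phi a b h k : 0 <= inner h (Phi (star b * b) h)
  + inner h (Phi (star b * a) k) + (inner k (Phi (star a * b) h)
  + inner k (Phi (star a * a) k)).
Proof.
have /cp_formP/(_ 2%N (fun i => if i == ord0 then b else a)
  (fun i => if i == ord0 then h else k)) := cp_positive Phi.
by rewrite !big_ord_recl !big_ord0/= !addr0 !innerDr.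
Qed.

(** The sesquilinear form (h, k) |-> <h, Phi(b^* a) k> has the adjoint
    (k, h) |-> <k, Phi(a^* b) h>: the sum of both is real by 2-positivity, for
    all h and k, in particular for i k in the place of k. *)
Lemma cp_hermitian Phi a b h k :
  ip k (Phi (star a * b) h) = ip h (Phi (star b * a) k).
Proof.
have im k' : complex.Im (inner h (Phi (star b * a) k')
    + inner k' (Phi (star a * b) h)) = 0.
  have := ger0_Im (cp_two_positive Phi a b h k').
  have := ger0_Im (cp_inner_ge0 Phi b h).
  have := ger0_Im (cp_inner_ge0 Phi a k').
  case: (inner h _) => ? ?; case: (inner k' _) => ? ?.
  case: (inner h _) => ? ?; case: (inner k' _) => ? ? /=; lra.
have := im ('i%C *: k); rewrite linearZ/= innerZr innerZl /ip.
case: (inner h _) => ? ?; case: (inner k _) => ? ? /=; lra.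
Qed.

(** Schwarz inequality, in its additive form; this form can be summed over
    several maps Phi. *)
Lemma cp_schwarz Phi a b h k : 2 * ip h (Phi (star b * a) k) <=
  ip h (Phi (star b * b) h) + ip k (Phi (star a * a) k).
Proof.
have /inner_ge0P[+ _] : 0 <= inner h (Phi (star b * b) h) by exact: cp_inner_ge0.
have [] := (cp_two_positive Phi a b (- h) k).
rewrite -[- h]scaleN1r !linearZ/= !innerZl !innerZr.
have := cp_hermitian Phi a b h k.
rewrite lecE /ip => + /andP[_]. 
case: (inner h _) => ? ?; case: (inner k _) => ? ?.
case: (inner h _) => ? ?; case: (inner k _) => ? ? /=; lra.
Qed.

(** The quadratic form of the positive operator Phi(1); it controls Phi. *)
Definition qform Phi h : R := ip h (Phi 1 h).

Lemma qform_ge0 Phi h : 0 <= qform Phi h.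
Proof. by have := cp_ip_ge0 Phi 1 h; rewrite star1 mulr1. Qed.

Lemma qform_bound Phi :
  exists2 M : R, 0 < M & forall h, qform Phi h <= M * rnorm h ^+ 2.
Proof.
have [M M0 PM] := bounded_op_bound (Phi 1); exists M => // h.
rewrite (le_trans (ip_le _ _))// expr2 mulrCA ler_wpM2l ?rnorm_ge0//.
Qed.

(** For c > |a| ^ 2 the element 1 - a^* a / c is a square b b with b
    self-adjoint, so that Phi(1) - Phi(a^* a) / c = Phi(b^* b) is positive. *)
Lemma cp_starM_le Phi a h :
  ip h (Phi (star a * a) h) <= rnorm a ^+ 2 * qform Phi h.
Proof.
have q0 := qform_ge0 Phi h.
suff le c : rnorm a ^+ 2 < c -> ip h (Phi (star a * a) h) <= c * qform Phi h.
  apply/ler_addgt0Pr => e e0; have d0 : 0 < e / (qform Phi h + 1).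
    by rewrite divr_gt0// ltr_wpDl.
  have := le (rnorm a ^+ 2 + e / (qform Phi h + 1)).
  rewrite ltrDl => /(_ d0)/le_trans; apply; rewrite mulrDl lerD2l mulrAC.
  by rewrite ler_pdivrMr ?ltr_wpDl// ler_pM2l// lerDl.
move=> ac; have c0 : 0 < c by rewrite (le_lt_trans _ ac)// exprn_ge0// rnorm_ge0.
pose x := c^-1%:C *: (star a * a).
have xsa : star x = x by rewrite /x starZr starMr starK.
have x1 : rnorm x < 1.
  by rewrite /x rnormZ gtr0_norm ?invr_gt0// rnorm_starM mulrC ltr_pdivrMr// mul1r.
have [b bsa bb] := cstar_sqrt xsa x1.
have := cp_ip_ge0 Phi b h; rewrite bsa bb linearB/= -/(qform _ _).
rewrite /x linearZ/= ipBr subr_ge0 ipZr mulrC ler_pdivrMr//.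
by rewrite mulrC.
Qed.

(** The basic estimate: Phi is dominated by the quadratic form of Phi(1). It is
    cp_schwarz for 1 and a / c, multiplied by c. *)
Lemma cp_le Phi a h k c : rnorm a <= c ->
  2 * ip h (Phi a k) <= c * (qform Phi h + qform Phi k).
Proof.
move=> ac; have : 0 <= c by rewrite (le_trans _ ac)// rnorm_ge0.
rewrite le_eqVlt => /predU1P[c0|c0].
  have -> : a = 0 by apply/eqP; rewrite -rnorm_eq0 eq_le rnorm_ge0 c0 ac.
  by rewrite linear0 ip0r mulr0 -c0 mul0r.
pose b := c^-1%:C *: a.
have b1 : rnorm b <= 1.
  by rewrite /b rnormZ gtr0_norm ?invr_gt0// mulrC ler_pdivrMr// mul1r.
have -> : a = c%:C *: b.
  by rewrite /b scalerA -rmorphM/= divff ?gt_eqF// scale1r.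
rewrite linearZ/= ipZr mulrCA ler_pM2l//.
have := cp_schwarz Phi b 1 h k; rewrite star1 !mul1r => /le_trans; apply.
rewrite lerD2l (le_trans (cp_starM_le _ _ _))// ler_piMl ?qform_ge0//.
by rewrite expr_le1// rnorm_ge0.
Qed.

(** Strong norms reduce to the quadratic form of k alone; this is why limits
    below exist strongly and not only weakly. *)
Lemma cp_rnorm_sqr Phi M a k : 0 < M ->
  (forall h, qform Phi h <= M * rnorm h ^+ 2) ->
  rnorm (Phi a k) ^+ 2 <= M * ip k (Phi (star a * a) k).
Proof.
move=> M0 PM; apply: rnorm_sqr_le => // h.
have := cp_schwarz Phi a 1 h k; rewrite star1 !mul1r => /le_trans; apply.
by rewrite lerD2r; exact: PM.
Qed.

End cp_maps.

(** * Construction and limits of completely positive maps *)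

Section cp_construction.
Context {R : realType} {A : cstarAlgType R} {H : hilbertType R}.
Implicit Types (a b : A) (h k : H) (Phi : CPmap A H).

(** Two bundled linear maps with the same function differ by proofs only. *)
Lemma cp_eq Phi Phi' : (forall a h, Phi a h = Phi' a h) -> Phi = Phi'.
Proof.
move=> PP; have : cp_fun Phi = cp_fun Phi' :> (A -> boundedOp H).
  by apply/funext => a; exact/bop_eq/PP.
case: Phi Phi' {PP} => [[f cf] pf] [[g cg] pg] /= fg.
subst g; have -> : cf = cg.
  case: cf cg {pf pg} => [[c1] [c2]] [[d1] [d2]].
  by rewrite (Prop_irrelevance c1 d1) (Prop_irrelevance c2 d2).
by rewrite (Prop_irrelevance pf pg).
Qed.

Lemma exists_cp (phi : A -> boundedOp H) : linear phi -> cp_form phi ->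
  exists Phi : CPmap A H, Phi =1 phi.
Proof.
move=> lin cpf.
pose L : {linear A -> boundedOp H} :=
  HB.pack phi (GRing.isLinear.Build R[i] A (boundedOp H) *:%R phi lin).
have cpL : completely_positive L by apply/cp_formP.
by exists (Build_CPmap cpL).
Qed.

(** The form in which strong limits arise: functions H -> H, one for each a. *)
Lemma exists_cp_fun (phi : A -> H -> H) :
  (forall a, linear (phi a)) ->
  (forall a, exists M, forall h, rnorm (phi a h) <= M * rnorm h) ->
  (forall c a b h, phi (c *: a + b) h = c *: phi a h + phi b h) ->
  (forall n (c : 'I_n -> A) (h : 'I_n -> H),
    0 <= \sum_i inner (h i) (\sum_j phi (star (c i) * c j) (h j))) ->
  exists Phi : CPmap A H, forall a h, Phi a h = phi a h.
Proof.
move=> lin bnd linA cpf.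
have mem a : phi a \in @bounded_linear R H.
  rewrite inE; split=> //; have [M phiM] := bnd a; exists M%:C => h.
  by rewrite -!rnormE -rmorphM/= lecR.
pose T a := BoundedOp (mem a).
have [||Phi PhiT] := @exists_cp T.
- by move=> c a b; apply: bop_eq => h; exact: linA.
- exact: cpf.
by exists Phi => a h; rewrite PhiT.
Qed.

Lemma sum_inner_ge0P n (h v : 'I_n -> H) :
  0 <= \sum_i inner (h i) (v i) <->
  0 <= \sum_i ip (h i) (v i) /\ \sum_i ip (h i) ('i%C *: v i) = 0.
Proof.
have re (z : 'I_n -> R[i]) :
    complex.Re (\sum_i z i) = \sum_i complex.Re (z i).
  exact: (big_morph _ (@complexReD R)).
rewrite lecE Im_Re mulr_sumr !re oppr_eq0.
under [in X in X && _]eq_bigr do rewrite -innerZr.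
by split=> [/andP[/eqP ? ?]//|[? ->]]; rewrite eqxx.
Qed.

Lemma cvg_sum (T : Type) (F : set_system T) (FF : Filter F) (K : numFieldType)
    (V : normedModType K) (I : Type) (r : seq I) (u : I -> T -> V) (l : I -> V) :
  (forall i, u i t @[t --> F] --> l i) ->
  \sum_(i <- r) u i t @[t --> F] --> \sum_(i <- r) l i.
Proof. by move=> ul; apply: cvg_big => //; exact: add_continuous. Qed.

(** A net of completely positive maps that is bounded, and strongly Cauchy at
    every a, converges to a completely positive map: linearity, boundedness
    and positivity all pass to strong limits. Both directions of the
    correspondence are limits of this kind. *)
Lemma cp_lim (T : Type) (F : set_system T) (FF : ProperFilter F)
    (Psi : T -> CPmap A H) (M : R) : 0 < M ->
  (\forall t \near F, forall h, qform (Psi t) h <= M * rnorm h ^+ 2) ->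
  (forall a k (e : R), 0 < e -> exists2 P : set T, F P &
    forall s t, P s -> P t -> rnorm (Psi s a k - Psi t a k) < e) ->
  exists Phi : CPmap A H, forall a k, Psi t a k @[t --> F] --> Phi a k.
Proof.
move=> M0 PM PC; pose phi a k : H := lim (Psi t a k @[t --> F]).
have cphi a k : Psi t a k @[t --> F] --> phi a k.
  by apply: cvg_cauchy_rnorm; exact: PC.
have phi_lim a k l : Psi t a k @[t --> F] --> l -> phi a k = l.
  by move/cvg_lim; apply; exact: norm_hausdorff.
clearbody phi; suff [Phi Phi_phi] : exists Phi : CPmap A H, forall a k, Phi a k = phi a k.
  by exists Phi => a k; rewrite Phi_phi.
apply: exists_cp_fun => [a c h k|a|c a b k|n c h].
- apply: phi_lim; under eq_fun do rewrite linearP/=.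
  by apply: cvgD => //; apply: cvgZr.
- exists (M * rnorm a) => h.
  apply: (@cvgr_to_le _ F _ _ (fun t => rnorm (Psi t a h))); first exact: rnorm_cvg.
  apply: filterS PM => t PM.
  have Ma : 0 <= M * rnorm a by rewrite mulr_ge0 ?rnorm_ge0// ltW.
  rewrite -ler_sqr ?nnegrE ?rnorm_ge0 ?mulr_ge0 ?rnorm_ge0 ?(ltW M0)//.
  apply: (le_trans (cp_rnorm_sqr a h M0 PM)).
  have := cp_starM_le (Psi t) a h; have := PM h => q1 q2.
  rewrite -mulrA exprMn expr2 -[leRHS]mulrA ler_pM2l// (le_trans q2)//.
  by rewrite exprMn mulrCA ler_wpM2l// exprn_ge0// rnorm_ge0.
- apply: phi_lim.
  under eq_fun do rewrite linearP/=.
  by apply: cvgD => //; apply: cvgZr.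
pose v t i : H := \sum_j Psi t (star (c i) * c j) (h j).
pose w i : H := \sum_j phi (star (c i) * c j) (h j).
have vw i : v t i @[t --> F] --> w i by apply: cvg_sum => j; exact: cphi.
have v0 t : 0 <= \sum_i inner (h i) (v t i).
  by have /cp_formP := cp_positive (Psi t); exact.
apply/sum_inner_ge0P; split.
  have : \sum_i ip (h i) (v t i) @[t --> F] --> \sum_i ip (h i) (w i).
    by apply: cvg_sum => i; exact: ip_cvg.
  move=> /cvgr_to_ge; apply; apply: nearW => t.
  by have /sum_inner_ge0P[] := v0 t.
have : \sum_i ip (h i) ('i%C *: v t i) @[t --> F] --> \sum_i ip (h i) ('i%C *: w i).
  by apply: cvg_sum => i; apply: ip_cvg; exact: cvgZr.
have -> : (fun t => \sum_i ip (h i) ('i%C *: v t i)) = cst 0.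
  by apply/funext => t; have /sum_inner_ge0P[] := v0 t.
move=> /cvg_lim <-//; exact: lim_cst.
Qed.

End cp_construction.

(** * Borel sets and complex measures *)

Section borel_algebra.
Context {X : topologicalType}.
Implicit Types E F : borelSet X.

Lemma borel_eq E F : E = F :> set X -> E = F.
Proof.
case: E F => [E bE] [F bF] /= EF; subst F.
by rewrite (Prop_irrelevance bE bF).
Qed.

Lemma open_borel (O : set X) : open O -> <<s @open X >> O.
Proof. exact: sub_sigma_algebra. Qed.

Definition openB (O : set X) (oO : open O) := BorelSet (open_borel oO).

Definition borel0 : borelSet X := openB open0.
Definition borelT : borelSet X := openB openT.
Definition borelC E : borelSet X := borelD borelT E.
Definition borelI E F : borelSet X := borelD E (borelC F).
Definition borelU E F : borelSet X := borelC (borelI (borelC E) (borelC F)).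

Lemma borelCE E : borelC E = ~` E :> set X.
Proof. by rewrite /= setTD. Qed.

Lemma borelIE E F : borelI E F = E `&` F :> set X.
Proof. by rewrite /= setTD setDE setCK. Qed.

Lemma borelIP E F x : (borelI E F : set X) x -> (E : set X) x /\ (F : set X) x.
Proof. by rewrite borelIE. Qed.

Lemma borelUE E F : borelU E F = E `|` F :> set X.
Proof. by rewrite borelCE borelIE !borelCE setCI !setCK. Qed.

Lemma closed_borel (C : set X) : closed C -> <<s @open X >> C.
Proof.
move=> cC; have oC : open (~` C) by exact: closed_openC.
by have := borelP (borelC (openB oC)); rewrite borelCE setCK.
Qed.

Definition closedB (C : set X) (cC : closed C) := BorelSet (closed_borel cC).

Lemma borel_bigcup_ord (F : nat -> borelSet X) n :
  <<s @open X >> (\bigcup_(i in `I_n) (F i : set X)).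
Proof.
have -> : \bigcup_(i in `I_n) (F i : set X) =
    \bigcup_i (if (i < n)%N then F i : set X else set0).
  apply/seteqP; split=> [x [i /= i_n Fi]|x [i _]]; first by exists i; rewrite ?i_n.
  by case: ifPn => // i_n Fi; exists i.
apply: sigma_algebra_bigcup => i; case: ifP => _; first exact: borelP.
exact: sigma_algebra0.
Qed.

Definition partition_of (T : Type) (F : T -> borelSet X) (E : set X) :=
  trivIset setT (fun t => F t : set X) /\ \bigcup_t (F t : set X) = E.

Lemma partition_of_inj (T : Type) (F : T -> borelSet X) (E : set X) s t x :
  partition_of F E -> (F s : set X) x -> (F t : set X) x -> s = t.
Proof. by move=> [Fd _] Fs Ft; apply: Fd => //; exists x. Qed.

End borel_algebra.

Section complex_measures.
Context {R : realType} {X : topologicalType}.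
Variables (mu : borelSet X -> R[i]) (mumeas : complex_measure mu).

(** The constant sequence of empty sets sums to its value on the empty set, so
    its partial sums converge, and their increments tend to 0. *)
Lemma complex_measure0 : mu borel0 = 0.
Proof.
have h : (fun n => \sum_(i < n) mu borel0 : R[i]^o) @ \oo --> (mu borel0 : R[i]^o).
  apply: (@mumeas (fun=> borel0) borel0).
    by move=> i j _ _ [x []].
  by rewrite /= bigcup0.
have hS : (fun n => \sum_(i < n.+1) mu borel0 : R[i]^o) @ \oo --> (mu borel0 : R[i]^o).
  by rewrite -(cvg_shiftS (fun n => \sum_(i < n) mu borel0 : R[i]^o)) in h.
have := cvgB hS h; rewrite subrr => d0.
pose S n : R[i]^o := \sum_(i < n) mu borel0.
have : (fun n => S n.+1 - S n) @ \oo --> (0 : R[i]^o) by exact: d0.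
have -> : (fun n => S n.+1 - S n) = cst (mu borel0 : R[i]^o).
  by apply/funext => n; rewrite /S big_ord_recr/= addrAC subrr add0r.
by move/cvg_lim => <-//; rewrite lim_cst.
Qed.

(** A finite family is continued by empty sets. *)
Lemma complex_measure_fin (T : finType) (F : T -> borelSet X) (E : borelSet X) :
  partition_of F E -> mu E = \sum_t mu (F t).
Proof.
move=> [Fd FE]; pose G i := if insub i is Some j then F (enum_val (j : 'I_#|T|))
  else borel0.
have Gx i x : (G i : set X) x -> exists2 j : 'I_#|T|, i = j & (F (enum_val j) : set X) x.
  by rewrite /G; case: insubP => //= j _ ji Fx; exists j.
have GE (j : 'I_#|T|) : G j = F (enum_val j) by rewrite /G valK.
have := mumeas (F := G) (E := E).
have triv : trivIset setT (fun n => G n : set X).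
  move=> i j _ _ [x [/Gx[i' -> Fi] /Gx[j' -> Fj]]]; congr (val _).
  by apply: enum_val_inj; apply: Fd => //; exists x.
have EG : E = \bigcup_n (G n : set X) :> set X.
  rewrite -FE; apply/seteqP; split=> [x [t _ Ft]|x [i _ /Gx[j _ Fj]]].
    by exists (enum_rank t) => //; rewrite GE enum_rankK.
  by exists (enum_val j).
move=> /(_ triv EG) cv.
have : (fun n => \sum_t mu (F t) : R[i]^o) @ \oo --> (mu E : R[i]^o).
  apply: cvg_trans cv.
  apply: (@near_eq_cvg nat R[i]^o \oo _); exists #|T| => // n /= Tn.
  have G0 i : ~~ (i < #|T|)%N -> mu (G i) = 0.
    by move=> iT; rewrite /G insubN// complex_measure0.
  rewrite -(big_mkord xpredT (fun i => mu (G i))) (big_cat_nat (leq0n _) Tn)//=.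
  rewrite [X in _ + X]big_nat_cond [X in _ + X]big1 ?addr0; last first.
    by move=> i /andP[/andP[Ti _] _]; rewrite G0// -leqNgt.
  rewrite big_mkord [RHS](reindex (@enum_val T predT)) /=.
    by apply: eq_bigr => j _; rewrite GE.
  by exists enum_rank => ? _; rewrite ?enum_valK ?enum_rankK.
by move/cvg_lim => <-//; rewrite lim_cst.
Qed.

End complex_measures.

(** * Sums of an instrument over partitions *)

Section qform_facts.
Context {R : realType} {A : cstarAlgType R} {H : hilbertType R}.

Lemma qform_unit (Phi : CPmap A H) (u : R[i]) h : `|u| = 1 ->
  qform Phi (u *: h) = qform Phi h.
Proof.
move=> u1; rewrite /qform /ip linearZ/= innerZl innerZr mulrA.
by rewrite [_^* * _]mulrC -sqr_normc u1 expr1n mul1r.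
Qed.

Lemma qformN (Phi : CPmap A H) h : qform Phi (- h) = qform Phi h.
Proof. by rewrite -scaleN1r qform_unit// normrN1. Qed.

Lemma norm_inner_le (h w : H) (t : R) :
  (forall u : R[i], `|u| = 1 -> ip (u *: h) w <= t) -> `|inner h w| <= t%:C.
Proof.
move=> wt; apply: norm_le_Re => u u1; have := wt u^*.
rewrite normcJ /ip innerZl => /(_ u1).
by congr (complex.Re (_ * _) <= _); exact: conjcK.
Qed.

End qform_facts.

Section instrument_sums.
Context {R : realType} {X : topologicalType} {A : cstarAlgType R}
  {H : hilbertType R}.
Variables (I : borelSet X -> CPmap A H) (Imeas : cp_instrument I).
Implicit Types (a : A) (h k : H) (E F : borelSet X).

Lemma instr_add (T : finType) (F : T -> borelSet X) E a k :
  partition_of F E -> I E a k = \sum_t I (F t) a k.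
Proof.
move=> FE; apply: ip_eq => h; rewrite ip_sumr /ip.
rewrite -[inner h _]/(matrix_elem I h k E a) (complex_measure_fin (@Imeas h k a) FE).
exact: (big_morph _ (@complexReD R)).
Qed.

(** The empty set is partitioned by the empty family. *)
Lemma instr0 E a k : E = set0 :> set X -> I E a k = 0.
Proof.
move=> E0; have -> : E = borel0 by exact: borel_eq.
rewrite (@instr_add void (fun=> borel0)); first by rewrite big_pred0// => -[].
by split=> [[]//|]; apply/seteqP; split=> [x [[]]|x].
Qed.

Lemma instr_add2 E F a k : F `<=` E -> I E a k = I F a k + I (borelD E F) a k.
Proof.
move=> FE; pose G b := if b then F else borelD E F.
rewrite (@instr_add bool G) ?big_bool//.
split=> [|]; first by move=> [] [] _ _ [x []]//=; [move=> ? []|case].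
apply/seteqP; split=> [x [[] _ //=]|x Ex]; [exact: FE|by case|].
by have [Fx|Fx] := pselect ((F : set X) x); [exists true|exists false].
Qed.

Lemma qform_add (T : finType) (F : T -> borelSet X) E h :
  partition_of F E -> qform (I E) h = \sum_t qform (I (F t)) h.
Proof. by move=> FE; rewrite /qform (instr_add _ _ FE) ip_sumr. Qed.

Lemma qform_mono E F h : F `<=` E -> qform (I F) h <= qform (I E) h.
Proof.
move=> FE; rewrite /qform (instr_add2 1 h FE) ipDr lerDl.
exact: (qform_ge0 (I (borelD E F))).
Qed.

(** cp_le on each cell, summed; cells that are empty contribute 0 whatever the
    value of b there. *)
Lemma instr_sum_le (T : finType) (F : T -> borelSet X) E (b : T -> A) (c : R)
    h k : partition_of F E ->
  (forall t x, (F t : set X) x -> rnorm (b t) <= c) -> 0 <= c ->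
  2 * ip h (\sum_t I (F t) (b t) k) <= c * (qform (I E) h + qform (I E) k).
Proof.
move=> FE bc c0; rewrite ip_sumr mulr_sumr !(qform_add _ FE) -big_split mulr_sumr.
apply: ler_sum => t _.
have [F0|/set0P[x Fx]] := eqVneq (F t : set X) set0; last exact/cp_le/bc/Fx.
rewrite (instr0 _ _ F0) ip0r mulr0 mulr_ge0// addr_ge0//; exact: qform_ge0.
Qed.

(** Two Riemann sums are compared on the common refinement of their
    partitions. *)
Lemma riemann_dist (S T : finType) (E : S -> borelSet X) (F : T -> borelSet X)
    (a : S -> A) (b : T -> A) (c : R) h k :
  partition_of E setT -> partition_of F setT -> 0 <= c ->
  (forall s t x, (E s : set X) x -> (F t : set X) x -> rnorm (a s - b t) <= c) ->
  2 * ip h (\sum_s I (E s) (a s) k - \sum_t I (F t) (b t) k)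
    <= c * (qform (I borelT) h + qform (I borelT) k).
Proof.
move=> PE PF c0 abc; pose G (p : S * T) := borelI (E p.1) (F p.2).
have Gx p x : (G p : set X) x -> (E p.1 : set X) x /\ (F p.2 : set X) x.
  by rewrite borelIE.
have GxI s t x : (E s : set X) x -> (F t : set X) x -> (G (s, t) : set X) x.
  by rewrite borelIE.
have PG : partition_of G (borelT : borelSet X).
  split=> [[s t] [s' t'] _ _ [x [Gx1 Gx2]]|].
    have [/= Es Ft] := Gx _ _ Gx1; have [/= Es' Ft'] := Gx _ _ Gx2.
    by rewrite (partition_of_inj PE Es Es') (partition_of_inj PF Ft Ft').
  apply/seteqP; split=> // x _.
  have [s _ Es] : (\bigcup_s (E s : set X)) x by rewrite PE.2.
  have [t _ Ft] : (\bigcup_t (F t : set X)) x by rewrite PF.2.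
  by exists (s, t) => //; exact: GxI.
have PGE s : partition_of (fun t => G (s, t)) (E s).
  split=> [t t' _ _ [x [Gx1 Gx2]]|].
    have [/= _ Ft] := Gx _ _ Gx1; have [/= _ Ft'] := Gx _ _ Gx2.
    exact: partition_of_inj PF Ft Ft'.
  apply/seteqP; split=> [x [t _ /Gx[]]//|x Es].
  have [t _ Ft] : (\bigcup_t (F t : set X)) x by rewrite PF.2.
  by exists t => //; exact: GxI.
have PGF t : partition_of (fun s => G (s, t)) (F t).
  split=> [s s' _ _ [x [Gx1 Gx2]]|].
    have [/= Es _] := Gx _ _ Gx1; have [/= Es' _] := Gx _ _ Gx2.
    exact: partition_of_inj PE Es Es'.
  apply/seteqP; split=> [x [s _ /Gx[]]//|x Ft].
  have [s _ Es] : (\bigcup_s (E s : set X)) x by rewrite PE.2.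
  by exists s => //; exact: GxI.
have -> : \sum_s I (E s) (a s) k - \sum_t I (F t) (b t) k =
    \sum_p I (G p) (a p.1 - b p.2) k.
  under eq_bigr do rewrite (instr_add _ _ (PGE _)).
  under [X in _ - X]eq_bigr do rewrite (instr_add _ _ (PGF _)).
  rewrite [X in _ - X]exchange_big/= !pair_bigA/= -sumrB.
  by apply: eq_bigr => -[s t] _; rewrite linearB.
by apply: (instr_sum_le _ _ PG) => // -[s t] x /Gx[]; exact: abc.
Qed.

End instrument_sums.

(** * Riemann sums and the integral *)

Lemma finite_subcover (X : compactHausdorffType) (V : X -> set X) :
  (forall y, nbhs y (V y)) -> exists s : seq X, forall x, exists2 y, y \in s & V y x.
Proof.
move=> Vy; pose F : set_system (seq X) :=
  [set P | exists s0 : seq X, forall s : seq X, {subset s0 <= s} -> P s].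
have FF : Filter F.
  split; first by exists [::].
    move=> P Q [s0 sP] [s1 sQ]; exists (s0 ++ s1) => s ss.
    by split; [apply: sP|apply: sQ] => y ys; apply: ss; rewrite mem_cat ys ?orbT.
  by move=> P Q PQ [s0 sP]; exists s0 => s /sP/PQ.
have /compact_near_coveringP cov := @compact_space X.
have [x _|s0 /(_ s0)] := cov _ F (fun s x => exists2 y, y \in s & V y x) FF.
  exists (V x, [set s : seq X | x \in s]); first split=> /=; first exact: Vy.
    by exists [:: x] => s; apply; rewrite mem_head.
  by move=> [z s] [/= Vz xs]; exists x.
by move=> H; exists s0 => x; apply: H.
Qed.

Record tagged_partition (X : topologicalType) := TaggedPartition {
  tp_size : nat;
  tp_set : 'I_tp_size -> borelSet X;
  tp_tag : 'I_tp_size -> X;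
  tp_partition : partition_of tp_set setT }.
Arguments tp_set {X} t i.
Arguments tp_tag {X} t i.

Section riemann_sums.
Context {R : realType} {X : compactHausdorffType} {A : cstarAlgType R}.

Definition fine (L : seq (cfun X A)) (d : R) (p : tagged_partition X) :=
  forall f, f \in L -> forall i x, (tp_set p i : set X) x ->
    rnorm (f x - f (tp_tag p i)) <= d.

(** The open sets on which the functions of L oscillate by less than d cover
    X; a finite subcover is made disjoint by removing from each set the previous
    ones. A tag is the centre of its set in the cover, and may lie outside the
    disjoint cell. *)
Lemma exists_fine L d : 0 < d -> exists p, fine L d p.
Proof.
move=> d0; pose V y := [set x | forall f, f \in L -> rnorm (f x - f y) < d]°.
have Vy y : V y y.
  suff : forall L' : seq (cfun X A),
      \forall x \near y, forall f, f \in L' -> rnorm (f x - f y) < d by exact.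
  elim=> [|g L' IH]; first exact: nearW.
  have /cvg_rnormP/(_ _ d0) := @cts_fun _ _ g y.
  apply: filterS2 IH => x fx gx f; rewrite inE => /orP[/eqP ->|/fx//].
  by rewrite rdistC.
have [y|s sV] := @finite_subcover X V.
  by rewrite nbhsE; exists (V y) => //; split=> //; exact: open_interior.
pose n := size s; pose U (i : 'I_n) := V (tnth (in_tuple s) i).
pose W (i : 'I_n) := \bigcup_(j in [set j : 'I_n | (j < i)%N]) U j.
have oU i : open (U i) by exact: open_interior.
have oW i : open (W i) by apply: bigcup_open => j _; exact: oU.
pose E i := borelD (openB (oU i)) (openB (oW i)).
have PE : partition_of E setT.
  split=> [i j _ _ [x [[Ui Wi] [Uj Wj]]]|].
    have [ij|ji|] := ltngtP i j; last exact: ord_inj.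
      by exfalso; apply: Wj; exists i.
    by exfalso; apply: Wi; exists j.
  apply/seteqP; split=> // x _; have [y yD Vyx] := sV x.
  have ys : (index y s < n)%N by rewrite index_mem.
  have Ux : `[< U (Ordinal ys) x >].
    by apply/asboolP; rewrite /U (tnth_nth y)/= nth_index.
  case: (@arg_minnP _ (Ordinal ys) (fun i => `[< U i x >]) (fun i => i : nat) Ux).
  move=> i /asboolP Ui imin; exists i => //; split=> // -[j /= ji Uj].
  by have := imin j; rewrite leqNgt ji => /(_ (introT (asboolP _) Uj)).
exists (TaggedPartition (fun i => tnth (in_tuple s) i) PE) => f fL i x /= [Ui _].
by apply/ltW; exact: (interior_subset Ui).
Qed.

Definition refinement : set_system (tagged_partition X) :=
  [set P | exists L d, 0 < d /\ forall p, fine L d p -> P p].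

Global Instance refinement_filter : ProperFilter refinement.
Proof.
split; first by move=> [L [d [d0 P]]]; have [p /P] := exists_fine L d0.
split; first by exists [::], 1.
  move=> P Q [L [d [d0 LP]]] [L' [d' [d'0 LQ]]].
  exists (L ++ L'), (Num.min d d'); split; first by rewrite lt_min d0.
  move=> p fp; split; [apply: LP|apply: LQ] => f fL i x px.
    have fLL : f \in L ++ L' by rewrite mem_cat fL.
    by have := fp f fLL i x px; rewrite le_min => /andP[].
  have fLL : f \in L ++ L' by rewrite mem_cat fL orbT.
  by have := fp f fLL i x px; rewrite le_min => /andP[].
by move=> P Q PQ [L [d [d0 LP]]]; exists L, d; split=> // p /LP /PQ.
Qed.

Lemma refinement_fine f d : 0 < d -> refinement (fine [:: f] d).
Proof. by move=> d0; exists [:: f], d. Qed.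

End riemann_sums.

Section integral.
Context {R : realType} {X : compactHausdorffType} {A : cstarAlgType R}
  {H : hilbertType R}.
Implicit Types (a : A) (h k : H) (f : cfun X A).

(** Fine partitions exist, so two integrals share a Riemann sum. *)
Lemma is_integral_uniq (mu : borelSet X -> A -> R[i]) f v v' :
  is_integral mu f v -> is_integral mu f v' -> v = v'.
Proof.
move=> iv iv'; apply/eqP; rewrite -subr_eq0 -normr_le0.
apply/ler_addgt0Pr => e e0; have e2 : 0 < e / 2 by rewrite divr_gt0.
have [d d0 dv] := iv _ e2; have [d' d'0 dv'] := iv' _ e2.
pose c := Num.min (complex.Re d) (complex.Re d').
have c0 : 0 < c.
  by move: d0 d'0; rewrite lt_min !ltcE => /andP[_ ->] /andP[_ ->].
have cd : c%:C <= d.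
  by rewrite -[leRHS]RRe_real ?gtr0_real// lecR /c ge_min lexx.
have cd' : c%:C <= d'.
  by rewrite -[leRHS]RRe_real ?gtr0_real// lecR /c ge_min lexx orbT.
have [p pf] := exists_fine [:: f] c0.
have {}pf i x : (tp_set p i : set X) x -> `|f x - f (tp_tag p i)| <= c%:C.
  by rewrite -rnorm_le; exact/pf/mem_head.
have [pd pT] := tp_partition p.
rewrite add0r [e]splitr -(subrKA (\sum_i mu (tp_set p i) (f (tp_tag p i)))).
rewrite (le_trans (ler_normD _ _))// lerD//.
  by apply: dv => // i x /pf/le_trans; exact.
by rewrite distrC; apply: dv' => // i x /pf/le_trans; exact.
Qed.

Definition integral_of (I : borelSet X -> CPmap A H) (Phi : CPmap (cfun X A) H) :=
  forall f h k, is_integral (matrix_elem I h k) f (inner h (Phi f k)).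

Lemma integral_of_uniq I Phi Phi' :
  integral_of I Phi -> integral_of I Phi' -> Phi = Phi'.
Proof.
move=> IP IP'; apply: cp_eq => f k; apply: ip_eq => h; congr (complex.Re _).
exact: is_integral_uniq (IP f h k) (IP' f h k).
Qed.

(** A bound on the distance to the Riemann sums that is proportional to the
    mesh suffices for the convergence of these sums. *)
Lemma integral_of_bound (A' : cstarAlgType R) (Psi : CPmap A' H)
    (I : borelSet X -> CPmap A H) (Phi : CPmap (cfun X A) H) :
  (forall f n (F : 'I_n -> borelSet X) (b : 'I_n -> A) (d : R) h k,
    partition_of F setT -> 0 <= d ->
    (forall t x, (F t : set X) x -> rnorm (f x - b t) <= d) ->
    2 * ip h (Phi f k - \sum_t I (F t) (b t) k) <=
      d * (qform Psi h + qform Psi k)) ->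
  integral_of I Phi.
Proof.
move=> bnd f h k e e0.
pose q l := qform Psi l; have q0 l : 0 <= q l by exact: qform_ge0.
have {e0} [eR e0] : e = (complex.Re e)%:C /\ 0 < complex.Re e.
  by move: e0; case: e => e e'; rewrite ltcE/= => /andP[/eqP -> ->].
pose d := complex.Re e / (q h + q k + 1).
have K0 : 0 < q h + q k + 1 by rewrite ltr_wpDl// addr_ge0.
have d0 : 0 < d by rewrite divr_gt0.
exists d%:C; first by rewrite ltcR.
move=> n F b Fd FT Fb; have PF : partition_of F setT by [].
rewrite eR /matrix_elem -inner_sumr.
rewrite (_ : _ - _ = inner h (Phi f k - \sum_i I (F i) (b i) k)); last first.
  by rewrite -[- (\sum_i _)]scaleN1r innerDr innerZr mulN1r.
apply: norm_inner_le => u u1.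
have Fb' t x : (F t : set X) x -> rnorm (f x - b t) <= d.
  by move=> /Fb; rewrite rnorm_le.
have := bnd f n F b d (u *: h) k PF (ltW d0) Fb'.
rewrite /q qform_unit// -!/(q _) => ud.
have : d * (q h + q k) <= complex.Re e.
  by rewrite /d mulrAC ler_pdivrMr// ler_pM2l// lerDl.
lra.
Qed.

Section existence.
Variables (I : borelSet X -> CPmap A H) (Imeas : cp_instrument I).

Lemma riemann_cp (p : tagged_partition X) : exists Psi : CPmap (cfun X A) H,
  forall f, Psi f = \sum_i I (tp_set p i) (f (tp_tag p i)).
Proof.
apply: exists_cp => [c f g|n c h].
  rewrite scaler_sumr -big_split/=; apply: eq_bigr => i _.
  exact: linearP.
rewrite [leRHS](_ : _ = \sum_l \sum_i inner (h i) (\sum_j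
    I (tp_set p l) (star (c i (tp_tag p l)) * c j (tp_tag p l)) (h j))).
  apply: sumr_ge0 => l _.
  by have /cp_formP/(_ _ (fun i => c i (tp_tag p l))) := cp_positive (I (tp_set p l)); exact.
rewrite exchange_big/=; apply: eq_bigr => i _; rewrite -inner_sumr.
congr (inner _ _); rewrite exchange_big/=; apply: eq_bigr => j _.
by rewrite bopE_sum.
Qed.

(** The limit of the Riemann sums along the refinement of tagged partitions. The
    second property is the explicit rate of convergence, on partitions that
    need not be tagged. *)
Lemma exists_integral : exists2 Phi : CPmap (cfun X A) H, integral_of I Phi &
  forall f (T : finType) (F : T -> borelSet X) (b : T -> A) (d : R) h k,
    partition_of F setT -> 0 <= d ->
    (forall t x, (F t : set X) x -> rnorm (f x - b t) <= d) ->
    2 * ip h (Phi f k - \sum_t I (F t) (b t) k) <=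
      d * (qform (I borelT) h + qform (I borelT) k).
Proof.
have /choice[Psi PsiE] := riemann_cp.
have PsiEk p f k : Psi p f k = \sum_i I (tp_set p i) (f (tp_tag p i)) k.
  by rewrite PsiE bopE_sum.
have [M M0 qM] := qform_bound (I borelT).
pose q h := qform (I borelT) h; have q0 h : 0 <= q h by exact: qform_ge0.
have qPsi p h : qform (Psi p) h = q h.
  rewrite /q (qform_add Imeas _ (tp_partition p : partition_of _ (borelT : borelSet X))).
  by rewrite /qform PsiEk ip_sumr.
have [|f k e e0|Phi PhiP] := @cp_lim _ _ _ _ (@refinement R X A) _ Psi _ M0.
- by apply: nearW => p h; rewrite qPsi.
- (* the bound below is (e / K) ^+ 2 * (K - 1), less than e ^+ 2 *)
  pose K := M * q k + 1; have K0 : 0 < K by rewrite ltr_wpDl// mulr_ge0// ltW.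
  pose d := e / K / 2; have d0 : 0 < d by rewrite !divr_gt0.
  exists (fine [:: f] d); first exact: refinement_fine.
  move=> p p' pd p'd; rewrite -ltr_sqr ?nnegrE ?rnorm_ge0 ?(ltW e0)//.
  have eK : 0 < e / K by rewrite divr_gt0.
  apply: (@le_lt_trans _ _ (e / K * M * (e / K * q k))).
    apply: rnorm_sqr_le => [|h]; first by rewrite mulr_gt0.
    rewrite !PsiEk; apply: (@le_trans _ _ (e / K * (q h + q k))).
      apply: (riemann_dist Imeas); [exact: tp_partition|exact: tp_partition|exact: ltW|].
      move=> s t x ps pt; rewrite -(subrKA (f x)) (le_trans (rnormD _ _))//.
      rewrite (splitr (e / K)) lerD//; last exact/p'd/pt/mem_head.
      by rewrite rdistC; exact/pd/ps/mem_head.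
    by rewrite -[e / K * M * _]mulrA -mulrDr ler_pM2l// lerD2r.
  rewrite (_ : _ * _ = e ^+ 2 * ((K - 1) / K ^+ 2)); last first.
    by rewrite /K; field; rewrite gt_eqF.
  rewrite gtr_pMr ?exprn_gt0// ltr_pdivrMr ?exprn_gt0// mul1r.
  have : 1 <= K by rewrite /K lerDr mulr_ge0// ltW.
  nra.
have bnd f (T : finType) (F : T -> borelSet X) (b : T -> A) (d : R) h k :
    partition_of F setT -> 0 <= d ->
    (forall t x, (F t : set X) x -> rnorm (f x - b t) <= d) ->
    2 * ip h (Phi f k - \sum_t I (F t) (b t) k) <= d * (q h + q k).
  move=> PF d0 Fd; apply/ler_addgt0Pr => e e0.
  pose K := q h + q k + 1; have K0 : 0 < K by rewrite ltr_wpDl// addr_ge0.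
  pose d' := e / K; have d'0 : 0 < d' by rewrite divr_gt0.
  apply: (@le_trans _ _ ((d + d') * (q h + q k))); last first.
    rewrite mulrDl lerD2l /d' mulrAC ler_pdivrMr// ler_pM2l// /K lerDl//.
  set v := \sum_t _.
  have : 2 * ip h (Psi p f k - v) @[p --> @refinement R X A] --> 2 * ip h (Phi f k - v).
    apply: cvgMr; apply: ip_cvg; apply: cvgB; first exact: PhiP.
    exact: cvg_cst.
  move=> /cvgr_to_le; apply; apply: filterS (refinement_fine f d'0) => p pd.
  rewrite PsiEk; apply: (riemann_dist Imeas) => //; first exact: tp_partition.
    by rewrite addr_ge0// ltW.
  move=> s t x ps Ft; rewrite -(subrKA (f x)) (le_trans (rnormD _ _))//.
  by rewrite addrC lerD ?(Fd _ _ Ft)// rdistC; exact/pd/ps/mem_head.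
exists Phi => //; apply: (integral_of_bound (Psi := I borelT)) => *.
exact: bnd.
Qed.

End existence.

End integral.

(** * Continuous cut-off functions *)

Section scalar_functions.
Context {R : realType} {X : compactHausdorffType}.

Definition between (C U : set X) (g : X -> R) :=
  [/\ forall x, 0 <= g x <= 1, forall x, C x -> g x = 1 &
      forall x, ~ U x -> g x = 0].

Lemma urysohn_between (C U : set X) : closed C -> open U -> C `<=` U ->
  exists g : continuousType X R, between C U g.
Proof.
move=> cC oU CU.
have nX := compact_normal (@hausdorff X) (@compact_space X).
have : ~` U `&` C = set0.
  by apply/seteqP; split=> // x [nO /CU].
move=> /(normal_uniform_separator nX (open_closedC oU) cC).
move=> /(@uniform_separatorP _ R)[f [fc f01 f0 f1]].
exists (mkcts fc); split=> x.
- by have := f01 (f x); rewrite /= in_itv/=; apply; exists x.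
- by move=> Cx; apply: f1; exists x.
- by move=> Ux; apply: f0; exists x.
Qed.

Context {A : cstarAlgType R}.

Lemma rnorm_cfun_ge (f : cfun X A) x : rnorm (f x) <= rnorm f.
Proof. by rewrite -lecR !rnormE; exact: sup_norm_ge. Qed.

Lemma rnorm_cfun_le (f : cfun X A) t : 0 <= t ->
  (forall x, rnorm (f x) <= t) -> rnorm f <= t.
Proof.
move=> t0 ft; rewrite rnorm_le; apply: sup_norm_le; first by rewrite ler0c.
by move=> x; rewrite -rnorm_le.
Qed.

Lemma smul_continuous (g : continuousType X R) (f : cfun X A) :
  continuous (fun x => (g x)%:C *: f x).
Proof.
move=> x; apply/cvg_rnormP => e e0.
have K0 : 0 < `|g x| + rnorm f + 1 by rewrite ltr_wpDl// addr_ge0// rnorm_ge0.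
have d0 : 0 < e / (`|g x| + rnorm f + 1) by rewrite divr_gt0.
have /cvg_rnormP/(_ _ d0) := @cts_fun _ _ f x.
have /cvgrPdist_lt/(_ _ d0) := @cts_fun _ _ g x.
apply: filterS2 => y gy fy.
rewrite -(subrKA ((g x)%:C *: f y)) -scalerBr -scalerBl -rmorphB/=.
rewrite (le_lt_trans (rnormD _ _))// !rnormZ.
apply: (@le_lt_trans _ _ (e / (`|g x| + rnorm f + 1) * (`|g x| + rnorm f))).
  rewrite mulrDr lerD//; first by rewrite mulrC ler_wpM2r// ltW.
  rewrite ler_pM ?rnorm_ge0 ?(ltW gy)//; exact: rnorm_cfun_ge.
by rewrite mulrAC ltr_pdivrMr// ltr_pM2l// ltrDl.
Qed.

Definition smul (g : continuousType X R) (f : cfun X A) : cfun X A :=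
  mkcts (@smul_continuous g f).

Definition cconst (a : A) : cfun X A := cst a.

End scalar_functions.

(** * Regular instruments are determined by their integral *)

Section uniqueness.
Context {R : realType} {X : compactHausdorffType} {A : cstarAlgType R}
  {H : hilbertType R}.
Implicit Types (a : A) (h k : H) (I : regularCPInstrument X A H).

(** Regularity for the pair (h, h) and the element 1, of norm at most 1, bounds
    the scalar measure of h. *)
Lemma regular_qform I h (E : borelSet X) e : 0 < e ->
  exists C U, [/\ closed C, open U, C `<=` E, E `<=` U &
    forall D : borelSet X, D `<=` U `\` C -> qform (I D) h < e].
Proof.
move=> e0; have [U [C [oU EU cC CE mu]]] := @instr_regular _ _ _ _ I h h E e e0.
exists C, U; split=> // [|D DUC]; first exact: compact_closed (@hausdorff X) cC.
apply: le_lt_trans (qform_mono (E := borelD U C) (@instr_measure _ _ _ _ I) h DUC) _.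
rewrite -lte_fin; apply: le_lt_trans mu; apply: ereal_sup_ubound.
exists 1; first by rewrite /mkset -(rnormE (1 : A)) (_ : 1 = 1%:C)// lecR rnorm1_le1.
congr ((complex.Re _)%:E); apply: ger0_norm.
by have := cp_inner_ge0 (I (borelD U C)) 1 h; rewrite star1 mulr1.
Qed.

(** The integral of g a, where g lies between the indicators of C and U, is
    close to I(E) a for E between C and U: on a fine partition, the terms in C
    add up to I(C) a, those off U vanish, and those in D = U \ C are small. *)
Lemma integral_between I (Phi : CPmap (cfun X A) H) (C U : set X)
    (E D : borelSet X) (g : continuousType X R) a h k :
  integral_of I Phi -> closed C -> open U -> C `<=` E -> E `<=` U ->
  D = U `\` C :> set X -> between C U g ->
  2 * ip h (Phi (smul g (cconst a)) k - I E a k)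
    <= 2 * rnorm a * (qform (I D) h + qform (I D) k).
Proof.
move=> IPhi cC oU CE EU DUC [g01 gC gU]; set f := smul g _.
have Imeas := @instr_measure _ _ _ _ I.
have [Phi' IPhi' bnd] := exists_integral Imeas.
rewrite (integral_of_uniq IPhi IPhi').
pose q l := qform (I borelT) l; have q0 l : 0 <= q l by exact: qform_ge0.
pose r := rnorm a * (qform (I D) h + qform (I D) k).
have fx x : f x = (g x)%:C *: a by [].
have fle x : rnorm (f x) <= rnorm a.
  have /andP[g0 g1] := g01 x.
  by rewrite fx rnormZ ger0_norm// ler_piMl// rnorm_ge0.
suff le (d : R) : 0 < d ->
    2 * ip h (Phi' f k - I E a k) <= d * (q h + q k) + (r + r).
  apply/ler_addgt0Pr => e e0.
  have K0 : 0 < q h + q k + 1 by rewrite ltr_wpDl// addr_ge0.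
  have := le (e / (q h + q k + 1)); rewrite divr_gt0// => /(_ isT)/le_trans; apply.
  rewrite addrC -mulrA mulr2n mulrDl mul1r lerD2l mulrAC ler_pdivrMr// ler_pM2l//.
  by rewrite lerDl.
move=> d0; have [p pf] := exists_fine [:: f] d0.
have {}pf i x : (tp_set p i : set X) x -> rnorm (f x - f (tp_tag p i)) <= d.
  exact/pf/mem_head.
have PD : partition_of (fun i => borelI (tp_set p i) D) D.
  split=> [i j _ _ [x [xi xj]]|].
    have [pi _] := borelIP xi; have [pj _] := borelIP xj.
    exact: partition_of_inj (tp_partition p) pi pj.
  apply/seteqP; split=> [x [i _]|x Dx]; first by rewrite borelIE => -[].
  have [i _ pi] : (\bigcup_i (tp_set p i : set X)) x by rewrite (tp_partition p).2.
  by exists i => //; rewrite borelIE.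
pose CB := closedB cC; pose UB := openB oU.
(* f is within d of b, which is a on C, 0 off U, and a tag value of f on the
   cells of U \ C *)
pose F (t : ('I_(tp_size p) + bool)%type) := match t with
  | inl i => borelI (tp_set p i) D
  | inr b => if b then CB else borelC UB end.
pose b (t : ('I_(tp_size p) + bool)%type) := match t with
  | inl i => f (tp_tag p i) | inr b => if b then a else 0 end.
have FD i x : (F (inl i) : set X) x -> (tp_set p i : set X) x /\ (U `\` C) x.
  by rewrite borelIE -DUC.
have FU x : (borelC UB : set X) x -> ~ U x by rewrite borelCE.
have PF : partition_of F setT.
  split.
    move=> [i|[]] [j|[]] _ _ [x [/= Fs Ft]] //.
    - by have [pi _] := FD _ _ Fs; have [pj _] := FD _ _ Ft;
        rewrite (partition_of_inj (tp_partition p) pi pj).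
    - by have [_ []] := FD _ _ Fs.
    - by have [_ [/(FU _ Ft)]] := FD _ _ Fs.
    - by have [_ []] := FD _ _ Ft.
    - by have /CE/EU/(FU _ Ft) := Fs.
    - by have [_ [/(FU _ Fs)]] := FD _ _ Ft.
    - by have /CE/EU/(FU _ Fs) := Ft.
  apply/seteqP; split=> // x _.
  have [Cx|nCx] := pselect (C x); first by exists (inr true).
  have [Ux|nUx] := pselect (U x); last first.
    by exists (inr false) => //; rewrite borelCE.
  have [i _ pi] : (\bigcup_i (tp_set p i : set X)) x by rewrite (tp_partition p).2.
  by exists (inl i) => //; rewrite borelIE DUC.
have Fb t x : (F t : set X) x -> rnorm (f x - b t) <= d.
  case: t => [i /FD[/pf]//|[Cx|/FU nUx]] /=.
    by rewrite fx gC// scale1r subrr rnorm0 ltW.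
  by rewrite fx gU// scale0r subrr rnorm0 ltW.
have := bnd f _ F b d h k PF (ltW d0) Fb.
rewrite big_sumType/= big_bool/= linear0 addr0 => le1.
have le2 : 2 * ip h (\sum_i I (borelI (tp_set p i) D) (f (tp_tag p i)) k) <= r.
  by apply: (instr_sum_le Imeas) => // *; exact: rnorm_ge0.
have le3 : 2 * ip (- h) (I (borelD E CB) a k) <= r.
  apply: (le_trans (cp_le _ _ _ (lexx _))).
  rewrite /r ler_wpM2l ?rnorm_ge0// qformN.
  by apply: lerD; apply: (qform_mono Imeas) => x; rewrite DUC => -[/EU].
have CBE : CB `<=` E by exact: CE.
move: le1 le2 le3; rewrite (instr_add2 Imeas a k CBE).
set s := \sum_i _; set u := I CB a k; set v := I (borelD E CB) a k.
rewrite (ipC (- h)) ipNr !(ipC _ h) !ipBr !ipDr -/(q _) -/(q _); lra.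
Qed.

(** Both instruments are compared with Phi(g a), for one g that is good for both
    instruments and for both vectors. *)
Lemma instrument_uniq I I' (Phi : CPmap (cfun X A) H) :
  integral_of I Phi -> integral_of I' Phi -> I = I'.
Proof.
move=> IPhi IPhi'.
suff II' : instr I = instr I'.
  move: II'; clear IPhi IPhi'; case: I I' => [I Im Ir] [I' Im' Ir'] /= II'; subst I'.
  by rewrite (Prop_irrelevance Im Im') (Prop_irrelevance Ir Ir').
apply/funext => E; apply: cp_eq => a k; apply: ip_eq => h.
suff le (J J' : regularCPInstrument X A H) (l : H) :
    integral_of J Phi -> integral_of J' Phi ->
    ip l (J E a k) <= ip l (J' E a k).
  by apply/eqP; rewrite eq_le !le.
move=> {IPhi IPhi' I I'} JPhi JPhi'.
apply/ler_addgt0Pr => e e0.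
pose d := e / (4 * (rnorm a + 1)).
have a0 := rnorm_ge0 a.
have K0 : 0 < 4 * (rnorm a + 1) by rewrite mulr_gt0// ltr_wpDl.
have d0 : 0 < d by rewrite divr_gt0.
have [C1 [U1 [cC1 oU1 CE1 EU1 le1]]] := regular_qform J l E d0.
have [C2 [U2 [cC2 oU2 CE2 EU2 le2]]] := regular_qform J k E d0.
have [C3 [U3 [cC3 oU3 CE3 EU3 le3]]] := regular_qform J' l E d0.
have [C4 [U4 [cC4 oU4 CE4 EU4 le4]]] := regular_qform J' k E d0.
pose C := (C1 `|` C2) `|` (C3 `|` C4); pose U := (U1 `&` U2) `&` (U3 `&` U4).
have cC : closed C by do !apply: closedU.
have oU : open U by do !apply: openI.
have CE : C `<=` E by move=> x [[]|[]]; [exact: CE1|exact: CE2|exact: CE3|exact: CE4].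
have EU : E `<=` U.
  by move=> x Ex; split; split; [exact: EU1|exact: EU2|exact: EU3|exact: EU4].
have [g gCU] := @urysohn_between R X C U cC oU (fun x Cx => EU x (CE x Cx)).
pose D := borelD (openB oU) (closedB cC).
have DE : D = U `\` C :> set X by [].
have {}le1 : qform (J D) l < d.
  by apply: le1 => x [[[U1x _] _] nC]; split=> // C1x; apply: nC; left; left.
have {}le2 : qform (J D) k < d.
  by apply: le2 => x [[[_ U2x] _] nC]; split=> // C2x; apply: nC; left; right.
have {}le3 : qform (J' D) l < d.
  by apply: le3 => x [[_ [U3x _]] nC]; split=> // C3x; apply: nC; right; left.
have {}le4 : qform (J' D) k < d.
  by apply: le4 => x [[_ [_ U4x]] nC]; split=> // C4x; apply: nC; right; right.
have := integral_between a (- l) k JPhi cC oU CE EU DE gCU.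
have := integral_between a l k JPhi' cC oU CE EU DE gCU.
rewrite qformN (ipC (- l)) ipNr !(ipC _ l) !ipBr.
set u := ip l (Phi _ _) => b1 b2.
have : rnorm a * (qform (J D) l + qform (J D) k + (qform (J' D) l + qform (J' D) k))
    <= rnorm a * (4 * d) by rewrite ler_wpM2l//; lra.
have : rnorm a * (4 * d) <= e.
  have -> : rnorm a * (4 * d) = e * (4 * rnorm a / (4 * (rnorm a + 1))).
    by rewrite /d; ring.
  by rewrite ler_piMr ?(ltW e0)// ler_pdivrMr//; lra.
lra.
Qed.

End uniqueness.

(** * Multiplication by scalar functions *)

Section scalar_algebra.
Context {R : realType} {X : compactHausdorffType} {A : cstarAlgType R}.
Local Notation B := (cfun X A : cstarAlgType R).
Implicit Types (g u : continuousType X R) (f : B) (C U E : set X).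

Lemma gmul_continuous g u : continuous (fun x => g x * u x).
Proof. by move=> x; apply: cvgM; exact: cts_fun. Qed.
Definition gmul g u : continuousType X R := mkcts (@gmul_continuous g u).

Lemma gadd_continuous g u : continuous (fun x => g x + u x).
Proof. by move=> x; apply: cvgD; exact: cts_fun. Qed.
Definition gadd g u : continuousType X R := mkcts (@gadd_continuous g u).

Lemma gsub_continuous g u : continuous (fun x => g x - u x).
Proof. by move=> x; apply: cvgB; exact: cts_fun. Qed.
Definition gsub g u : continuousType X R := mkcts (@gsub_continuous g u).

Definition gcst (t : R) : continuousType X R := cst t.

Lemma gsqrt_continuous g : continuous (fun x => Num.sqrt (g x)).
Proof.
move=> x; apply: (@continuous_comp _ _ _ g Num.sqrt); first exact: cts_fun.
exact: sqrt_continuous.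
Qed.
Definition gsqrt g : continuousType X R := mkcts (@gsqrt_continuous g).

(** The positive part of g - d. *)
Lemma gtrunc_continuous g (d : R) : continuous (fun x => Num.max (g x - d) 0).
Proof.
move=> x; apply: (@continuous_max _ _ (fun x => g x - d) (cst 0)).
  by apply: cvgB; [exact: cts_fun|exact: cvg_cst].
exact: cvg_cst.
Qed.
Definition gtrunc g d : continuousType X R := mkcts (@gtrunc_continuous g d).

Lemma closed_superlevel g (d : R) : closed [set x | d <= g x].
Proof.
have -> : [set x | d <= g x] = g @^-1` [set y | d <= y] by [].
by apply: closed_comp; [move=> x _; exact: cts_fun|exact: closed_ge].
Qed.

Lemma smulM g u f : smul g (smul u f) = smul (gmul g u) f.
Proof. by apply: cfunP => x; rewrite /= /mkcts scalerA -rmorphM. Qed.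

Lemma star_smul g f : star (smul g f) = smul g (star f).
Proof. by apply: cfunP => x; exact: starZr. Qed.

Lemma smul_mull g f1 f2 : (smul g f1 : B) * f2 = smul g (f1 * f2).
Proof. by apply: cfunP => x; symmetry; exact: cscaleAl. Qed.

Lemma smul_mulr g f1 f2 : f1 * (smul g f2 : B) = smul g (f1 * f2).
Proof. by apply: cfunP => x; symmetry; exact: cscaleAr. Qed.

Lemma smul_linear g (c : R[i]) f1 f2 :
  smul g (c *: f1 + f2) = c *: smul g f1 + smul g f2.
Proof.
apply: cfunP => x.
change ((g x)%:C *: (c *: f1 x + f2 x)
  = c *: ((g x)%:C *: f1 x) + (g x)%:C *: f2 x).
by rewrite scalerDr !scalerA mulrC.
Qed.

Lemma smulD g u f : smul (gadd g u) f = smul g f + smul u f.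
Proof. by apply: cfunP => x; rewrite [RHS]cfunD -scalerDl -rmorphD. Qed.

Lemma smulB g u f : smul (gsub g u) f = smul g f - smul u f.
Proof. by apply: cfunP => x; rewrite [RHS]cfunB -scalerBl -rmorphB. Qed.

Lemma smul_cst t f : smul (gcst t) f = t%:C *: f.
Proof. by apply: cfunP => x. Qed.

Lemma smul1 g f : (forall x, g x = 1) -> smul g f = f.
Proof. by move=> g1; apply: cfunP => x; rewrite /= /mkcts g1 scale1r. Qed.

Lemma rnorm_smul_le g f (d : R) : 0 <= d -> (forall x, 0 <= g x <= 1) ->
  (forall x, g x != 0 -> rnorm (f x) <= d) -> rnorm (smul g f) <= d.
Proof.
move=> d0 g01 fd; apply: rnorm_cfun_le => // x.
rewrite /= /mkcts rnormZ; have /andP[g0 g1] := g01 x.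
have [->|/fd fx] := eqVneq (g x) 0; first by rewrite normr0 mul0r.
by rewrite ger0_norm// -[d]mul1r ler_pM ?rnorm_ge0.
Qed.

Lemma between_mul C U g u : between C U g -> between C U u ->
  between C U (gmul g u).
Proof.
move=> [g01 gC gU] [u01 uC uU]; split=> x; rewrite /= /mkcts.
- have /andP[g0 g1] := g01 x; have /andP[u0 u1] := u01 x.
  by rewrite mulr_ge0// mulr_ile1.
- by move=> Cx; rewrite gC// uC// mulr1.
- by move=> Ux; rewrite gU// mul0r.
Qed.

(** Directed by shrinking U and growing C, the cut-offs converge to the indicator
    function of E in every L^2 space of a regular measure at once. *)
Definition cutoffs E : set_system (continuousType X R) :=
  [set P | exists C U, [/\ closed C, open U, C `<=` E, E `<=` U &
    forall g, between C U g -> P g]].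

Global Instance cutoffs_filter E : ProperFilter (cutoffs E).
Proof.
split.
  move=> [C [U [cC oU CE EU P]]].
  by have [g /P] := @urysohn_between R X C U cC oU (fun x Cx => EU x (CE x Cx)).
split.
- by exists set0, setT; split=> //; [exact: closed0|exact: openT].
- move=> P Q [C [U [cC oU CE EU CP]]] [D [V [cD oV DE EV DQ]]].
  exists (C `|` D), (U `&` V); split; [exact: closedU|exact: openI| | |].
  + by move=> x [/CE|/DE].
  + by move=> x Ex; split; [exact: EU|exact: EV].
  + move=> g [g01 g1 g0]; split.
      apply: CP; split=> // x; first by move=> Cx; apply: g1; left.
      by move=> Ux; apply: g0 => -[/Ux].
    apply: DQ; split=> // x; first by move=> Cx; apply: g1; right.
    by move=> Ux; apply: g0 => -[_ /Ux].
- move=> P Q PQ [C [U [cC oU CE EU CP]]].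
  by exists C, U; split=> // g /CP/PQ.
Qed.

Lemma cutoffs_between E C U : closed C -> open U -> C `<=` E -> E `<=` U ->
  cutoffs E (between C U).
Proof. by move=> cC oU CE EU; exists C, U. Qed.

(** The powers of a cut-off are cut-offs of the same set. Hence Phi(g f) and the
    completely positive Phi(g f g) have the same limit. *)
Lemma cutoffs_sqr E : gmul g g @[g --> cutoffs E] --> cutoffs E.
Proof.
move=> P [C [U [cC oU CE EU CP]]]; exists C, U; split=> // g gCU.
by apply: CP; exact: between_mul.
Qed.

Lemma cutoffs_cube E : gmul (gmul g g) g @[g --> cutoffs E] --> cutoffs E.
Proof.
move=> P [C [U [cC oU CE EU CP]]]; exists C, U; split=> // g gCU.
by apply: CP; do !apply: between_mul.
Qed.

End scalar_algebra.

(** * Regularity of the positive functionals of vectors *)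

Section mass.
Context {R : realType} {X : compactHausdorffType} {A : cstarAlgType R}
  {H : hilbertType R}.
Variable Phi : CPmap (cfun X A) H.
Local Notation B := (cfun X A : cstarAlgType R).
Implicit Types (g u : continuousType X R) (f : B) (h k : H)
  (C U V W E : set X).

(** Multiplication by g is central and self-adjoint, so g^2 a^* b = (g a)^* (g b). *)
Lemma compress_cp g : exists Psi : CPmap (cfun X A) H,
  forall f, Psi f = Phi (smul (gmul g g) f).
Proof.
apply: exists_cp => [c f1 f2|n c h].
  by rewrite smul_linear linearP.
have /cp_formP/(_ n (fun i => smul g (c i)) h) := cp_positive Phi.
congr (0 <= _); apply: eq_bigr => i _; congr (inner _ _).
apply: eq_bigr => j _; congr (Phi _ _).
by rewrite star_smul smul_mull smul_mulr smulM.
Qed.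

(** Integration of g against the scalar measure of k, a positive functional. *)
Definition mass k g : R := ip k (Phi (smul g (1 : B)) k).

Lemma massD k g u : mass k (gadd g u) = mass k g + mass k u.
Proof. by rewrite /mass smulD linearD ipDr. Qed.

Lemma mass_eq k g u : g =1 u -> mass k g = mass k u.
Proof.
move=> gu; rewrite /mass; congr (ip _ (Phi _ _)).
by apply: cfunP => x; rewrite /= /mkcts gu.
Qed.

Lemma mass_cstM k t g : mass k (gmul (gcst t) g) = t * mass k g.
Proof. by rewrite /mass -smulM smul_cst linearZ/= ipZr. Qed.

(** A nonnegative g is the square of a continuous function. *)
Lemma mass_ge0 k g : (forall x, 0 <= g x) -> 0 <= mass k g.
Proof.
move=> g0; have [Psi PsiE] := compress_cp (gsqrt g).
have := qform_ge0 Psi k; rewrite /qform PsiE.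
rewrite (@mass_eq k g (gmul (gsqrt g) (gsqrt g)))// => x.
by rewrite /= /mkcts -expr2 sqr_sqrtr.
Qed.

Lemma mass_mono k g u : (forall x, g x <= u x) -> mass k g <= mass k u.
Proof.
move=> gu; rewrite (@mass_eq k u (gadd g (gsub u g))).
  by rewrite massD lerDl mass_ge0// => x; rewrite /= /mkcts subr_ge0.
by move=> x; rewrite /= /mkcts addrC subrK.
Qed.

(** The continuity of Phi in the L^2 norm of the measure of k: this is what
    extends Phi from continuous functions to indicators of Borel sets. *)
Lemma mass_bound (M : R) g f k (t : R) : 0 < M ->
  (forall h, qform Phi h <= M * rnorm h ^+ 2) ->
  mass k (gmul g g) <= t ->
  rnorm (Phi (smul g f) k) ^+ 2 <= M * rnorm f ^+ 2 * t.
Proof.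
move=> M0 qM gt; apply: le_trans (cp_rnorm_sqr _ _ M0 qM) _.
rewrite -mulrA ler_pM2l//; have [Psi PsiE] := compress_cp g.
rewrite star_smul smul_mull smul_mulr smulM -PsiE.
apply: (le_trans (cp_starM_le _ _ _)); rewrite ler_wpM2l ?exprn_ge0 ?rnorm_ge0//.
by rewrite /qform PsiE.
Qed.

(** For U open: the scalar measure of k gives U mass at most e. Continuous
    functions below the indicator function of U express it without the
    measure. *)
Definition small k U (e : R) := forall g, between set0 U g -> mass k g <= e.

Lemma small_sub k U V e : V `<=` U -> small k U e -> small k V e.
Proof.
move=> VU Ue g [g01 _ g0]; apply: Ue; split=> // x Ux.
by apply: g0 => /VU.
Qed.

Lemma mass1_ge0 k : 0 <= mass k (gcst 1).
Proof. by apply: mass_ge0 => x; exact: ler01. Qed.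

Lemma mass_gtrunc k g (d : R) : 0 <= d -> (forall x, 0 <= g x) ->
  mass k g <= mass k (gtrunc g d) + d * mass k (gcst 1).
Proof.
move=> d0 g0; rewrite -mass_cstM -massD; apply: mass_mono => x.
by rewrite /= /mkcts mulr1 -lerBlDr le_max lexx.
Qed.

(** Subadditivity: a partition of unity subordinate to U and V on the set
    where g >= d splits the positive part of g - d. *)
Lemma small_setU k U V e1 e2 : open U -> open V ->
  small k U e1 -> small k V e2 -> small k (U `|` V) (e1 + e2).
Proof.
move=> oU oV Ue1 Ve2 g [g01 _ g0].
suff le d : 0 < d -> mass k g <= e1 + e2 + d * mass k (gcst 1).
  apply/ler_addgt0Pr => e e_gt0; have m0 := mass1_ge0 k.
  have K0 : 0 < mass k (gcst 1) + 1 by rewrite ltr_wpDl.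
  have := le (e / (mass k (gcst 1) + 1)); rewrite divr_gt0// => /(_ isT)/le_trans.
  by apply; rewrite lerD2l mulrAC ler_pdivrMr// ler_pM2l// lerDl.
move=> d0; pose C := [set x | d <= g x] `\` V.
have cC : closed C by rewrite /C setDE; apply: closedI;
  [exact: closed_superlevel|exact: open_closedC].
have CU : C `<=` U.
  move=> x [/= dg nVx]; apply: contrapT => nUx.
  by move: dg; rewrite g0 ?leNgt ?d0// => -[].
have [u [u01 u1 u0]] := @urysohn_between R X C U cC oU CU.
have t01 x : 0 <= gtrunc g d x <= 1.
  have /andP[gx0 gx1] := g01 x; rewrite /= /mkcts le_max lexx orbT ge_max ler01.
  by rewrite andbT lerBlDr (le_trans gx1)// lerDl ltW.
apply: le_trans (mass_gtrunc k (ltW d0) _) _; first by move=> x; have /andP[] := g01 x.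
rewrite lerD2r (@mass_eq k _ (gadd (gmul u (gtrunc g d))
    (gmul (gsub (gcst 1) u) (gtrunc g d)))); last first.
  by move=> x; rewrite /= /mkcts; ring.
rewrite massD lerD//; [apply: Ue1|apply: Ve2]; split=> // x.
- have /andP[? ?] := u01 x; have /andP[? ?] := t01 x.
  by rewrite /= /mkcts mulr_ge0//= mulr_ile1.
- by move=> /u0 ux; rewrite /= /mkcts ux mul0r.
- have /andP[? ?] := u01 x; have /andP[? ?] := t01 x.
  rewrite {1 2}/gmul/= /mkcts/= mulr_ge0 ?subr_ge0//=.
  by rewrite mulr_ile1 ?subr_ge0// gerBl.
- move=> nVx; have [dg|gd] := leP d (g x); last first.
    by rewrite /= /mkcts [X in _ * X]max_r ?mulr0// subr_le0 ltW.
  by rewrite /= /mkcts u1// subrr mul0r.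
Qed.

(** Inner and outer regularity of E for the scalar measure of k. *)
Definition tight k E := forall e, 0 < e -> exists C U,
  [/\ closed C, open U, C `<=` E, E `<=` U & small k (U `\` C) e].

Lemma tightC k E : tight k E -> tight k (~` E).
Proof.
move=> tE e /tE[C [U [cC oU CE EU CUe]]]; exists (~` U), (~` C); split.
- exact: open_closedC.
- exact: closed_openC.
- exact: subsetC.
- exact: subsetC.
- by apply: small_sub CUe => x [nC /contrapT Ux]; split.
Qed.

(** The supremum of the mass below U is almost attained at some g, and then at
    the positive part of g - d, supported in the closed set {g >= d}; the
    rest of U can carry only little mass. *)
Lemma tight_open k U : open U -> tight k U.
Proof.
move=> oU e e0; pose S :=
  [set mass k g | g in [set g : continuousType X R | between set0 U g]].
have Sub : has_ubound S.
  exists (mass k (gcst 1)) => _ [g [g01 _ _] <-].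
  by apply: mass_mono => x; have /andP[] := g01 x.
have Ssup : has_sup S.
  split=> //; exists (mass k (gcst 0)), (gcst 0) => //; split=> // x.
  by rewrite lexx ler01.
have e2 : 0 < e / 2 by rewrite divr_gt0.
have [_ [g [g01 _ g0] <-] supg] := sup_adherent e2 Ssup.
have m0 := mass1_ge0 k.
pose d := e / 2 / (mass k (gcst 1) + 1).
have d0 : 0 < d by rewrite divr_gt0// ltr_wpDl.
have dm : d * mass k (gcst 1) <= e / 2.
  by rewrite /d mulrAC ler_pdivrMr ?ltr_wpDl// ler_pM2l// lerDl.
exists [set x | d <= g x], U; split=> //.
- exact: closed_superlevel.
- move=> x /= dg; apply: contrapT => nUx.
  by move: dg; rewrite g0// leNgt d0.
- move=> f [f01 _ f0].
  have : mass k (gadd f (gtrunc g d)) <= sup S.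
    apply: ub_le_sup => //; exists (gadd f (gtrunc g d)) => //; split=> // x.
      have /andP[gx0 gx1] := g01 x; have /andP[fx0 fx1] := f01 x.
      rewrite /= /mkcts; have [dg|gd] := leP d (g x).
        rewrite f0 ?add0r; last by case.
        by rewrite le_max lexx orbT/= ge_max ler01 andbT lerBlDr (le_trans gx1)// lerDl ltW.
      by rewrite max_r ?addr0 ?f01// subr_le0 ltW.
    move=> nUx; rewrite /= /mkcts f0; last by case.
    by rewrite g0// sub0r max_r ?addr0// oppr_le0 ltW.
  have := mass_gtrunc k (ltW d0) (fun x => let: conj a _ := andP (g01 x) in a).
  rewrite massD; lra.
Qed.

Lemma compact_bigcup_ord C (U : nat -> set X) : closed C ->
  (forall n, open (U n)) -> C `<=` \bigcup_n U n ->
  exists N, forall x, C x -> exists2 i, (i < N)%N & U i x.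
Proof.
move=> cC oU CU.
have /compact_near_coveringP cov : compact C.
  by apply: subclosed_compact cC (@compact_space X) _.
have [x Cx|N _ /(_ N (leqnn N)) NC] :=
    cov _ \oo (fun n x => exists2 i, (i < n)%N & U i x) _.
  have [i _ Ui] := CU x Cx.
  exists (U i, [set n | (i < n)%N]); first split=> /=.
  - by rewrite nbhsE; exists (U i).
  - by exists i.+1.
  - by move=> [z n] [/= Uz n_i]; exists i.
by exists N.
Qed.

(** The gaps U_n \ C_n of mass e / 2 ^ (n + 1) have total mass at most e on every
    initial segment, by finite subadditivity. *)
Lemma tight_seq k (E : nat -> set X) e : (forall n, tight k (E n)) -> 0 < e ->
  exists C U : nat -> set X, (forall n, [/\ closed (C n), open (U n),
      C n `<=` E n & E n `<=` U n]) /\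
    forall N, small k (\bigcup_(n in `I_N) (U n `\` C n)) e.
Proof.
move=> tE e0.
have en n : 0 < e / 2 ^+ n.+1 by rewrite divr_gt0// exprn_gt0.
have [C /choice[U CU]] := choice (fun n => tE n _ (en n)).
exists C, U; split=> [n|N]; first by have [] := CU n.
have : small k (\bigcup_(n in `I_N) (U n `\` C n)) (e - e / 2 ^+ N).
  elim: N => [|N IH].
    rewrite expr0 divr1 subrr => g [_ _ g0]; rewrite (@mass_eq k _ (gmul (gcst 0) g)).
      by rewrite mass_cstM mul0r.
    by move=> x; rewrite /= /mkcts mul0r g0// => -[].
  have oW n : open (U n `\` C n).
    by have [cC oU _ _ _] := CU n; rewrite setDE; apply: openI => //; exact: closed_openC.
  have -> : e - e / 2 ^+ N.+1 = e - e / 2 ^+ N + e / 2 ^+ N.+1.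
    by rewrite exprS; field; rewrite expf_neq0.
  apply: small_sub (small_setU _ (oW N) IH _).
  - move=> x [n /= nN]; have [->|nN' Wx] := eqVneq n N; first by right.
    by left; exists n => //=; rewrite ltn_neqAle nN' -ltnS.
  - by apply: bigcup_open.
  - by have [] := CU N.
move=> sN g /sN/le_trans; apply.
by rewrite gerBl divr_ge0 ?exprn_ge0// ltW.
Qed.

(** A compact subset D of the union of the U_n carries almost all its mass, and
    is covered by finitely many U_n; so finitely many C_n suffice from inside. *)
Lemma tight_bigcup k (E : nat -> set X) : (forall n, tight k (E n)) ->
  tight k (\bigcup_n E n).
Proof.
move=> tE e e0; have e2 : 0 < e / 2 by rewrite divr_gt0.
have [C [U [CU sCU]]] := tight_seq tE e2.
have oV : open (\bigcup_n U n) by apply: bigcup_open => n _; have [] := CU n.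
have [D [V [cD oV' DU UV DVe]]] := tight_open k oV e2.
have [N DN] := compact_bigcup_ord cD (fun n => let: And4 _ oU _ _ := CU n in oU) DU.
exists (\bigcup_(n in `I_N) C n), (\bigcup_n U n); split=> //.
- by apply: closed_bigcup => [|n _]; [exact: finite_II|have [] := CU n].
- by move=> x [n _ Cx]; exists n => //; have [_ _ CE _] := CU n; exact: CE.
- by move=> x [n _ Ex]; exists n => //; have [_ _ _ EU] := CU n; exact: EU.
rewrite [e]splitr; apply: small_sub (small_setU _ _ DVe (sCU N)).
- move=> x [Ux nC]; have [/DN[n nN Un]|nD] := pselect (D x).
    by right; exists n => //; split=> // Cn; apply: nC; exists n.
  by left; split=> //; exact: UV.
- by rewrite setDE; apply: openI => //; exact: closed_openC.
- apply: bigcup_open => n _; have [cC oU _ _] := CU n.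
  by rewrite setDE; apply: openI => //; exact: closed_openC.
Qed.

(** The tight sets form a sigma-algebra containing the open sets. *)
Lemma tight_borel k (E : borelSet X) : tight k E.
Proof.
have := borelP E; apply; split=> [|U]; last exact: tight_open.
split.
- by apply: tight_open; exact: open0.
- by move=> F tF; rewrite setTD; exact: tightC.
- by move=> F tF; exact: tight_bigcup.
Qed.

End mass.

(** * Extension to indicator functions of Borel sets *)

Section extension.
Context {R : realType} {X : compactHausdorffType} {A : cstarAlgType R}
  {H : hilbertType R}.
Variable Phi : CPmap (cfun X A) H.
Local Notation B := (cfun X A : cstarAlgType R).
Implicit Types (g u : continuousType X R) (f : B) (h k : H)
  (C U V W : set X) (E F : borelSet X).

(** Two cut-offs differ on U \ C only, by at most 1. *)
Lemma small_gap C U k e g u : small Phi k (U `\` C) e ->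
  between C U g -> between C U u ->
  mass Phi k (gmul (gsub g u) (gsub g u)) <= e.
Proof.
move=> CUe [g01 gC gU] [u01 uC uU]; apply: CUe; split=> // x.
  have /andP[? ?] := g01 x; have /andP[? ?] := u01 x.
  change (0 <= (g x - u x) * (g x - u x) <= 1); rewrite -expr2 sqr_ge0/=.
  by rewrite -real_normK ?num_real// expr_le1// ler_norml; apply/andP; split; lra.
move=> nUC; have [Cx|nCx] := pselect (C x).
  by rewrite /= /mkcts /= /mkcts gC// uC// subrr mul0r.
have nUx : ~ U x by move=> Ux; apply: nUC.
by rewrite /= /mkcts /= /mkcts gU// uU// subrr mul0r.
Qed.

(** The map f |-> Phi(1_E f). By mass_bound and small_gap, Phi(g f) k is Cauchy
    along the cut-offs g of E; passing to the squares of the cut-offs, it is a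
    limit of the completely positive maps of compress_cp. *)
Lemma exists_extension E : exists J : CPmap (cfun X A) H,
  forall f k, Phi (smul g f) k @[g --> cutoffs E] --> J f k.
Proof.
have [M M0 qM] := qform_bound Phi.
have cauchy f k e : 0 < e -> exists2 P : set (continuousType X R),
    cutoffs (E : set X) P &
    forall g u, P g -> P u -> rnorm (Phi (smul g f) k - Phi (smul u f) k) < e.
  move=> e0; pose K := M * rnorm f ^+ 2.
  have K0 : 0 <= K by rewrite mulr_ge0 ?(ltW M0)// exprn_ge0// rnorm_ge0.
  have d0 : 0 < e ^+ 2 / (K + 1) by rewrite divr_gt0 ?exprn_gt0// ltr_wpDl.
  have [C [U [cC oU CE EU CUe]]] := tight_borel Phi k E d0.
  exists (between C U); first exact: cutoffs_between.
  move=> g u gCU uCU; rewrite -ltr_sqr ?nnegrE ?rnorm_ge0 ?(ltW e0)//.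
  have -> : Phi (smul g f) k - Phi (smul u f) k = Phi (smul (gsub g u) f) k.
    by rewrite smulB linearB.
  apply: (le_lt_trans (mass_bound f M0 qM (small_gap CUe gCU uCU))).
  rewrite -/K mulrA ltr_pdivrMr ?ltr_wpDl// mulrC.
  by rewrite ltr_pM2l ?exprn_gt0// ltrDl.
have /choice[Psi PsiE] := compress_cp Phi.
have limP f k : cvg (Phi (smul g f) k @[g --> cutoffs E]).
  by apply: cvg_cauchy_rnorm => e; exact: cauchy.
have [|f k e e0|J JP] := @cp_lim _ _ _ _ (cutoffs E) _ Psi _ M0.
- exists set0, setT; split=> //; [exact: closed0|exact: openT|].
  move=> g [g01 _ _] h; rewrite /qform PsiE; apply: le_trans (qM h).
  have -> : qform Phi h = mass Phi h (gcst 1) by rewrite /mass smul1.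
  apply: (@mass_mono _ _ _ _ Phi) => x; rewrite /= /mkcts.
  by have /andP[? ?] := g01 x; rewrite mulr_ile1.
- have [P FP Pe] := cauchy f k e e0.
  exists [set g | P (gmul g g)]; first exact: cutoffs_sqr.
  by move=> g u; rewrite !PsiE; exact: Pe.
exists J => f k.
have sq : Phi (smul (gmul g g) f) k @[g --> cutoffs E] -->
    lim (Phi (smul g f) k @[g --> cutoffs E]).
  exact: (cvg_comp _ _ (@cutoffs_sqr _ _ E) (limP f k)).
suff -> : J f k = lim (Phi (smul g f) k @[g --> cutoffs E]) by exact: limP.
apply: (@cvg_unique _ _ (Psi g f k @[g --> cutoffs E])); first exact: norm_hausdorff.
  exact: JP.
have -> : (fun g => Psi g f k) = (fun g => Phi (smul (gmul g g) f) k) => //.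
by apply/funext => g; rewrite PsiE.
Qed.

Definition extension E : CPmap (cfun X A) H := sval (cid (exists_extension E)).

Lemma extension_cvg E f k :
  Phi (smul g f) k @[g --> cutoffs E] --> extension E f k.
Proof. exact: (svalP (cid (exists_extension E))). Qed.

Lemma extension_approx E f k e d : 0 < e -> 0 < d -> exists C U g,
  [/\ C `<=` E, E `<=` U, open (U `\` C), small Phi k (U `\` C) d &
   between C U g /\ rnorm (extension E f k - Phi (smul g f) k) < e].
Proof.
move=> e0 d0; have [C [U [cC oU CE EU CUe]]] := tight_borel Phi k E d0.
have /cvg_rnormP/(_ _ e0) near_e := @extension_cvg E f k.
have near_b := @cutoffs_between R X E C U cC oU CE EU.
have [g [gCU ge]] := filter_ex (filterI near_b near_e).
exists C, U, g; split=> //.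
by rewrite setDE; apply: openI => //; exact: closed_openC.
Qed.

Lemma extensionT f k : extension borelT f k = Phi f k.
Proof.
have := @extension_cvg borelT f k.
move/cvg_lim => <-; last exact: norm_hausdorff.
apply: cvg_lim; first exact: norm_hausdorff.
apply/cvg_rnormP => e e0; exists setT, setT; split=> //.
- exact: openT.
- by move=> g [_ g1 _]; rewrite smul1 ?subrr ?rnorm0// => x; exact: g1.
Qed.

(** For cut-offs g1, g2, g3 of E, F and their union, w = g1 + g2 - g3 vanishes
    off the three gaps, which have small mass, and takes values in [-1, 2]. *)
Lemma extensionU E F f k : E `&` F = set0 :> set X ->
  extension (borelU E F) f k = extension E f k + extension F f k.
Proof.
move=> EF0; have [M M0 qM] := qform_bound Phi.
apply/eqP; rewrite -subr_eq0 -rnorm_eq0 eq_le rnorm_ge0 andbT.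
apply/ler_addgt0Pr => e e0; rewrite add0r.
have e4 : 0 < e / 4 by rewrite divr_gt0.
pose K := M * rnorm f ^+ 2 + 1.
have K0 : 0 < K by rewrite ltr_wpDl// mulr_ge0 ?(ltW M0)// exprn_ge0// rnorm_ge0.
(* three gaps of mass d, and w ^+ 2 <= 4 *)
pose d := (e / 4) ^+ 2 / (12 * K).
have d0 : 0 < d by rewrite divr_gt0 ?exprn_gt0// mulr_gt0.
have [C1 [U1 [g1 [CE1 EU1 o1 s1 [[b1 c1 z1] a1]]]]] := extension_approx E f k e4 d0.
have [C2 [U2 [g2 [CE2 EU2 o2 s2 [[b2 c2 z2] a2]]]]] := extension_approx F f k e4 d0.
have [C3 [U3 [g3 [CE3 EU3 o3 s3 [[b3 c3 z3] a3]]]]] :=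
  extension_approx (borelU E F) f k e4 d0.
pose w := gsub (gadd g1 g2) g3.
have sW : small Phi k ((U1 `\` C1) `|` (U2 `\` C2) `|` (U3 `\` C3)) (d + d + d).
  by apply: small_setU => //; [exact: openU|exact: small_setU].
(* off the gaps each cut-off has the value of its indicator function *)
have w0 x : ~ ((U1 `\` C1) `|` (U2 `\` C2) `|` (U3 `\` C3)) x -> w x = 0.
  move=> nW.
  have ind (C U : set X) (g : continuousType X R) : between C U g ->
      ~ (U `\` C) x -> (C x /\ g x = 1) \/ (~ U x /\ g x = 0).
    move=> [_ gC gU] nUC; have [Cx|nCx] := pselect (C x); first by left; rewrite gC.
    have nUx : ~ U x by move=> Ux; apply: nUC.
    by right; rewrite gU.
  rewrite /w /= /mkcts /= /mkcts.
  have [||[Cx1 ->]|[Ux1 ->]] := ind C1 U1 g1; first by split.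
    by move=> ?; apply: nW; left; left.
  - have [||[Cx2 ->]|[Ux2 ->]] := ind C2 U2 g2; first by split.
      by move=> ?; apply: nW; left; right.
    + have : (E `&` F : set X) x by split; [exact: CE1|exact: CE2].
      by rewrite EF0.
    + have [||[_ ->]|[Ux3 _]] := ind C3 U3 g3; [by split| | |].
      * by move=> ?; apply: nW; right.
      * by rewrite addr0 subrr.
      * by exfalso; apply: Ux3; apply: EU3; rewrite borelUE; left; exact: CE1.
  - have [||[Cx2 ->]|[Ux2 ->]] := ind C2 U2 g2; first by split.
      by move=> ?; apply: nW; left; right.
    + have [||[_ ->]|[Ux3 _]] := ind C3 U3 g3; [by split| | |].
      * by move=> ?; apply: nW; right.
      * by rewrite add0r subrr.
      * by exfalso; apply: Ux3; apply: EU3; rewrite borelUE; right; exact: CE2.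
    + have [||[Cx3 _]|[_ ->]] := ind C3 U3 g3; [by split| | |].
      * by move=> ?; apply: nW; right.
      * exfalso; have := CE3 _ Cx3; rewrite borelUE.
        by move=> [/EU1|/EU2].
      * by rewrite addr0 subr0.
have wm : mass Phi k (gmul w w) <= 4 * (d + d + d).
  have h0 : 0 < 4^-1 :> R by [].
  rewrite -ler_pdivrMl// -mass_cstM; apply: sW; split=> // x.
    have /andP[? ?] := b1 x; have /andP[? ?] := b2 x; have /andP[? ?] := b3 x.
    have wx : -1 <= w x <= 2 by rewrite /w /= /mkcts /= /mkcts; apply/andP; split; lra.
    change (0 <= 4^-1 * (w x * w x) <= 1); move: (w x) wx => t /andP[t1 t2].
    have : 0 <= (2 - t) * (2 + t) by rewrite mulr_ge0//; lra.
    by have := sqr_ge0 t; rewrite expr2 => *; apply/andP; split; lra.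
  by move=> /w0 wx; change (4^-1 * (w x * w x) = 0); rewrite wx !mulr0.
have wle : rnorm (Phi (smul w f) k) <= e / 4.
  rewrite -ler_sqr ?nnegrE ?rnorm_ge0 ?(ltW e4)//.
  apply: (le_trans (mass_bound f M0 qM wm)).
  have -> : M * rnorm f ^+ 2 = K - 1 by rewrite /K addrK.
  have -> : (K - 1) * (4 * (d + d + d)) = (e / 4) ^+ 2 * ((K - 1) / K).
    by rewrite /d; field; rewrite gt_eqF.
  by rewrite ger_pMr ?exprn_gt0// ler_pdivrMr// mul1r gerBl.
have wE : Phi (smul w f) k =
    Phi (smul g1 f) k + Phi (smul g2 f) k - Phi (smul g3 f) k.
  by rewrite /w smulB smulD linearB linearD.
set x3 := extension (borelU E F) f k; set x1 := extension E f k; set x2 := extension F f k.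
set y1 := Phi (smul g1 f) k in a1 wE; set y2 := Phi (smul g2 f) k in a2 wE.
set y3 := Phi (smul g3 f) k in a3 wE.
have -> : x3 - (x1 + x2) = (x3 - y3) - (x1 - y1) - (x2 - y2) - Phi (smul w f) k.
  have rearrange (V : zmodType) (a b c a' b' c' : V) :
      a - (b + c) = (a - a') - (b - b') - (c - c') - (b' + c' - a').
    have -> : (a - a') - (b - b') - (c - c') = (a - a') + ((b' + c') - (b + c)).
      by rewrite -addrA; congr (_ + _); rewrite !opprB addrACA -opprD.
    by rewrite opprB -[RHS]addrA [_ - _ + (a' - _)]addrC !subrKA.
  by rewrite wE -rearrange.
have := rnormD ((x3 - y3) - (x1 - y1) - (x2 - y2)) (- Phi (smul w f) k).
have := rnormD ((x3 - y3) - (x1 - y1)) (- (x2 - y2)).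
have := rnormD (x3 - y3) (- (x1 - y1)); rewrite !rnormN.
lra.
Qed.

Lemma extension_small E W e h : open W -> E `<=` W -> small Phi h W e ->
  qform (extension E) h <= e.
Proof.
move=> oW EW We; apply: (@cvgr_to_le _ (cutoffs E) _ _
  (fun g => mass Phi h g)); first by apply: ip_cvg; exact: extension_cvg.
exists set0, W; split=> //; exact: closed0.
Qed.

(** The estimate cp_le localized to E: eventually g is supported where f is less
    than d', and Phi(g^3 f) is Phi(g . g) at g f, of norm at most d'. *)
Lemma extension_bound E f d h k : (forall x, (E : set X) x -> rnorm (f x) <= d) ->
  0 <= d ->
  2 * ip h (extension E f k) <= d * (qform (extension E) h + qform (extension E) k).
Proof.
move=> Ed d0; set s := (_ + _).
have s0 : 0 <= s by rewrite addr_ge0// qform_ge0.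
suff le d' : d < d' -> 2 * ip h (extension E f k) <= d' * s.
  apply/ler_addgt0Pr => e e0; have K0 : 0 < s + 1 by rewrite ltr_wpDl.
  have := le (d + e / (s + 1)); rewrite ltrDl divr_gt0// => /(_ isT)/le_trans; apply.
  by rewrite mulrDl lerD2l mulrAC ler_pdivrMr// ler_pM2l// lerDl.
move=> dd'; have d'0 : 0 <= d' by rewrite (le_trans d0)// ltW.
pose W := [set x | rnorm (f x) < d'].
have oW : open W.
  apply: (@open_comp _ _ (fun x => rnorm (f x)) [set y | y < d']); last exact: open_lt.
  move=> x _; have fc : continuous (f : X -> A) by exact: cts_fun.
  exact: (continuous_comp (fc x) (@rnorm_continuous R A (f x))).
have EW : E `<=` W by move=> x /Ed fx; exact: le_lt_trans fx dd'.
have sq l : mass Phi l (gmul g g) @[g --> cutoffs E] --> qform (extension E) l.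
  apply: (@ip_cvg _ _ _ _ _ (fun g => Phi (smul (gmul g g) (1 : B)) l)).
  exact: (cvg_comp _ _ (@cutoffs_sqr _ _ E) (@extension_cvg E 1 l)).
have cube : Phi (smul (gmul (gmul g g) g) f) k @[g --> cutoffs E] --> extension E f k.
  exact: (cvg_comp _ _ (@cutoffs_cube _ _ E) (@extension_cvg E f k)).
have L1 : 2 * ip h (Phi (smul (gmul (gmul g g) g) f) k) @[g --> cutoffs E] -->
    2 * ip h (extension E f k) by apply: cvgMr; exact: ip_cvg.
have L2 : d' * (mass Phi h (gmul g g) + mass Phi k (gmul g g)) @[g --> cutoffs E] -->
    d' * s by apply: cvgMr; exact: cvgD.
rewrite -subr_ge0; apply: (cvgr_to_ge (cvgB L2 L1)).
exists set0, W; split=> //; first exact: closed0.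
move=> g [g01 _ g0]; rewrite subr_ge0.
have [Psi PsiE] := compress_cp Phi g.
have fg : rnorm (smul g f) <= d'.
  apply: rnorm_smul_le => // x gx.
  have [Wx|nWx] := pselect (W x); first exact: ltW.
  by move: gx; rewrite g0// eqxx.
have := cp_le Psi h k fg; rewrite /qform !PsiE smulM.
by congr (2 * ip _ (Phi _ _) <= _); apply: cfunP.
Qed.

Lemma extension_ord (F : nat -> borelSet X) E f k n :
  trivIset setT (fun n => F n : set X) ->
  E = \bigcup_(i in `I_n) (F i : set X) :> set X ->
  extension E f k = \sum_(i < n) extension (F i) f k.
Proof.
move=> Fd; elim: n E => [|n IH] E EF.
  rewrite big_ord0; have E0 : E = borelU borel0 borel0.
    by apply: borel_eq; rewrite borelUE EF setU0 II0 bigcup_set0.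
  have E00 : E = borel0 by apply: borel_eq; rewrite EF II0 bigcup_set0.
  have := extensionU f k (setI0 _ : borel0 `&` borel0 = set0 :> set X).
  by rewrite -E0 -E00 => /esym/eqP; rewrite -subr_eq0 addrK => /eqP.
rewrite big_ord_recr/= -(IH (BorelSet (borel_bigcup_ord F n)))// -extensionU/=; last first.
  apply/seteqP; split=> // x [[i /= i_n Fi] Fn].
  have : i = n by apply: Fd => //; exists x.
  by move: i_n => /[swap] ->; rewrite ltnn.
congr (bop_fun (extension _ _) _); apply: borel_eq; rewrite borelUE EF/=.
apply/seteqP; split=> x.
  move=> [i /= ]; rewrite ltnS leq_eqVlt => /predU1P[->|i_n] Fi; first by right.
  by left; exists i.
move=> [[i /= i_n Fi]|Fn]; [exists i => //=|by exists n => //=].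
by rewrite ltnW.
Qed.

End extension.

(** * The instrument of a completely positive map *)

Section instrument_of_cp.
Context {R : realType} {X : compactHausdorffType} {A : cstarAlgType R}
  {H : hilbertType R}.
Variable Phi : CPmap (cfun X A) H.
Implicit Types (h k : H) (E : borelSet X).

(** Continuity at the empty set. The remainder of the union beyond its first n
    terms lies, up to a small set, in a compact subset K of the union, and K is
    covered by finitely many open approximations of the terms. *)
Lemma extension_tail (F : nat -> borelSet X) E e h : 0 < e ->
  E = \bigcup_n (F n : set X) :> set X ->
  \forall n \near \oo, qform (extension Phi
    (borelD E (BorelSet (borel_bigcup_ord F n)))) h <= e.
Proof.
move=> e0 EF; have e2 : 0 < e / 2 by rewrite divr_gt0.
have [C [U [CU sCU]]] := tight_seq (fun n => tight_borel Phi h (F n)) e2.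
have [D [V [cD oV DE EV DVe]]] := tight_borel Phi h E e2.
have oU n : open (U n) by have [] := CU n.
have DU : D `<=` \bigcup_n U n.
  move=> x /DE; rewrite EF => -[n _ Fx]; exists n => //.
  by have [_ _ _ FU] := CU n; exact: FU.
have [N DN] := compact_bigcup_ord cD oU DU.
have oUC n : open (U n `\` C n).
  by have [cC _ _ _] := CU n; rewrite setDE; apply: openI => //; exact: closed_openC.
exists N => // n /= Nn; rewrite [e]splitr.
have oW : open (\bigcup_(i in `I_n) (U i `\` C i)) by exact: bigcup_open.
have oVD : open (V `\` D).
  by rewrite setDE; apply: openI => //; exact: closed_openC.
apply: extension_small (small_setU oVD oW DVe (sCU n)); first exact: openU.
move=> x [/= Ex nF]; have [Dx|nDx] := pselect (D x); last first.
  by left; split=> //; exact: EV.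
have [i iN Ui] := DN x Dx; right; exists i => /=; first exact: leq_trans Nn.
split=> // Ci; apply: nF; exists i => /=; first exact: leq_trans Nn.
by have [_ _ CF _] := CU i; exact: CF.
Qed.

(** The extension is an instrument on C(X, A); countable additivity is
    extension_tail, because cp_le bounds the remainder by its mass for h and
    for k. *)
Lemma extension_instrument : cp_instrument (extension Phi).
Proof.
move=> h k f F E Fd EF; apply/(@cvg_rnormP R R[i]^o) => e e0.
have K0 : 0 < rnorm f + 1 by rewrite ltr_wpDl// rnorm_ge0.
have d0 : 0 < e / (rnorm f + 1) by rewrite divr_gt0.
have := extension_tail k d0 EF; have := extension_tail h d0 EF.
apply: filterS2 => n qh qk.
set G := BorelSet (borel_bigcup_ord F n); set D := borelD E G in qh qk.
have EGD : E = borelU G D.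
  apply: borel_eq; rewrite borelUE /=; apply/seteqP; split=> x.
    by move=> Ex; have [Gx|nGx] := pselect ((G : set X) x); [left|right].
  by move=> [[i _ Fi]|[]//]; rewrite EF; exists i.
have GD : G `&` D = set0 :> set X by apply/seteqP; split=> // x [Gx [_ /(_ Gx)]].
rewrite /matrix_elem -inner_sumr -(extension_ord Phi f k Fd (E := G))//.
rewrite [in X in X - _]EGD (extensionU _ _ _ GD) innerDr addrC addKr.
rewrite rnorm_lt; apply: (@le_lt_trans _ _ ((rnorm f * (e / (rnorm f + 1)))%:C)).
  apply: norm_inner_le => u u1; have := cp_le (extension Phi D) (u *: h) k (lexx (rnorm f)).
  rewrite qform_unit// => le.
  have : rnorm f * (qform (extension Phi D) h + qform (extension Phi D) k) <=
    rnorm f * (e / (rnorm f + 1) + e / (rnorm f + 1)).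
    by rewrite ler_wpM2l ?rnorm_ge0// lerD.
  lra.
rewrite ltcR mulrCA gtr_pMr// ltr_pdivrMr// mul1r ltrDl//.
Qed.

(** Constant functions embed A in C(X, A). The integral of f is Phi(f), because
    on a cell of the partition f and its constant value differ by at most d. *)
Lemma exists_instrument :
  exists I : regularCPInstrument X A H, integral_of I Phi.
Proof.
have restrict E : exists J : CPmap A H,
    forall a, J a = extension Phi E (cconst a).
  apply: exists_cp => [c a b|n c h].
    rewrite -linearP; congr (extension Phi E _); exact: cfunP.
  have /cp_formP/(_ n (fun i => cconst (c i)) h) := cp_positive (extension Phi E).
  congr (0 <= _); apply: eq_bigr => i _; congr (inner _ _).
  by apply: eq_bigr => j _; congr (extension Phi E _ _); exact: cfunP.
have /choice[I IE] := restrict.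
have Iq E h : qform (I E) h = qform (extension Phi E) h.
  by rewrite /qform IE.
have Imeas : cp_instrument I.
  move=> h k a; have IJ : (fun E' => matrix_elem I h k E' a) =
      (fun E' => matrix_elem (extension Phi) h k E' (cconst a)).
    by apply/funext => E'; rewrite /matrix_elem IE.
  by rewrite IJ; exact: extension_instrument.
have Ireg : regular_instrument I.
  move=> h k E e e0; have e2 : 0 < e / 2 by rewrite divr_gt0.
  have [C1 [U1 [cC1 oU1 CE1 EU1 s1]]] := tight_borel Phi h E e2.
  have [C2 [U2 [cC2 oU2 CE2 EU2 s2]]] := tight_borel Phi k E e2.
  have oU := openI oU1 oU2; have cC := closedU cC1 cC2.
  exists (openB oU), (closedB cC); split=> //.
  - by move=> x Ex; split; [exact: EU1|exact: EU2].
  - by apply: subclosed_compact cC (@compact_space X) _.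
  - by move=> x [/CE1|/CE2].
  set D := borelD _ _.
  have oD : open (D : set X).
    by rewrite /D /= setDE; apply: openI => //; exact: closed_openC.
  have qh : qform (I D) h <= e / 2.
    rewrite Iq; apply: extension_small oD _ _ => //; apply: small_sub s1.
    by move=> x [[Ux _] nC]; split=> // Cx; apply: nC; left.
  have qk : qform (I D) k <= e / 2.
    rewrite Iq; apply: extension_small oD _ _ => //; apply: small_sub s2.
    by move=> x [[_ Ux] nC]; split=> // Cx; apply: nC; right.
  apply: (@le_lt_trans _ _ (e / 2)%:E); last first.
    by rewrite lte_fin ltr_pdivrMr// mulr_natr mulr2n ltrDl.
  apply: ge_ereal_sup => _ [a a1 <-]; rewrite lee_fin.
  rewrite -[X in _ <= X]/(complex.Re (e / 2)%:C).
  have : `|matrix_elem I h k D a| <= (e / 2)%:C.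
    apply: norm_inner_le => u u1.
    have a1' : rnorm a <= 1 by rewrite rnorm_le.
    have := cp_le (I D) (u *: h) k a1'; rewrite qform_unit//; lra.
  by rewrite lecE => /andP[].
exists (Build_regularCPInstrument Imeas Ireg) => /=.
apply: (integral_of_bound (Psi := Phi)) => f n F b d h k PF d0 Fb.
have Jadd := instr_add extension_instrument.
have -> : Phi f k - \sum_t I (F t) (b t) k =
    \sum_t extension Phi (F t) (f - cconst (b t)) k.
  rewrite -extensionT (Jadd _ F borelT)// -sumrB; apply: eq_bigr => t _.
  by rewrite IE linearB.
have qT l : qform Phi l = \sum_t qform (extension Phi (F t)) l.
  rewrite -(qform_add extension_instrument l (E := borelT))//.
  by rewrite /qform extensionT.
rewrite ip_sumr mulr_sumr !qT -big_split mulr_sumr; apply: ler_sum => t _.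
by apply: extension_bound => // x /Fb.
Qed.

End instrument_of_cp.

(** * The correspondence *)

Theorem theorem3p35 (R : realType) (X : compactHausdorffType)
    (A : cstarAlgType R) (H : hilbertType R) :
  exists Phi : regularCPInstrument X A H -> CPmap (cfun X A) H,
    bijective Phi /\
    forall (I : regularCPInstrument X A H) (f : cfun X A) (h k : H),
      is_integral (matrix_elem I h k) f (inner h (Phi I f k)).
Proof.
have /choice[Phi PhiP] (I : regularCPInstrument X A H) :
    exists Phi : CPmap (cfun X A) H, integral_of I Phi.
  by have [Phi] := exists_integral (@instr_measure _ _ _ _ I); exists Phi.
have /choice[I IP] := @exists_instrument R X A H.
exists Phi; split=> [|J f h k]; last exact: PhiP.
exists I => [J|Psi]; first exact: instrument_uniq (IP (Phi J)) (PhiP J).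
exact: integral_of_uniq (PhiP (I Psi)) (IP Psi).
Qed.
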